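(* Let $L\ge1$ be an integer and let $X_n=g(A_n)$, $n\ge1$, be the stationary sequence defined in the context, with mean $\mu_X=\mathbb{E}[X_n]$ and $\tau_X=\lim_{K\to\infty}\mathrm{Var}\left[\frac{1}{\sqrt K}\sum_{n=1}^{K}(X_n-\mu_X)\right]$. Then, as $K\to\infty$, $$\frac{1}{\sqrt{K}}\sum_{k=1}^{K}(X_k-\mu_X)$$ converges in distribution to the normal distribution $\mathcal{N}(0,\tau_X)$ with mean $0$ and variance $\tau_X$.
   Context: Let $(b_n)_{n\in\mathbb{Z}}$ be i.i.d. random blocks uniformly distributed on $\{0,1\}^L$ (independent fair bits; this is the stationary case $Q\to\infty$ of infinitely many initialization blocks). For $n\ge1$ let $A_n=\min\{m\in\mathbb{N}: m\ge1,\ b_{n-m}=b_n\}$, which is almost surely finite. Let $g(i)=\frac{1}{\ln 2}\sum_{j=1}^{i-1}\frac1j$ for integers $i\ge1$ (so $g(1)=0$), and $X_n=g(A_n)$. The mean $\mu_X$ exists and does not depend on $n$, and the limit $\tau_X$ exists and is finite. $\mathcal{N}(0,0)$ is understood as the point mass at $0$. *)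

(* Defs.v *)
From HB Require Import structures.
From mathcomp Require Import all_boot all_order all_algebra finmap.
From mathcomp Require Import all_classical all_reals all_analysis.
From mathcomp Require Import measurable_realfun.

Set Implicit Arguments.
Unset Strict Implicit.
Unset Printing Implicit Defensive.

Import Order.TTheory GRing.Theory Num.Theory.
Import numFieldTopology.Exports.

Local Open Scope classical_set_scope.
Local Open Scope ring_scope.

Definition mutually_independent (I : choiceType) (d d' : measure_display)
    (T : measurableType d) (T' : measurableType d') (R : realType)
    (P : probability T R) (Y : I -> {RV P >-> T'}) : Prop :=
  forall (J : {fset I}) (B : I -> set T'),
    (forall i, i \in J -> measurable (B i)) ->
    P (\bigcap_(i in [set` J]) (Y i @^-1` B i)) =
    (\prod_(i <- J) P (Y i @^-1` B i))%E.

Arguments mutually_independent {I d d' T T' R} P Y.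

(* [L.-tuple bool] carries the product of discrete sigma-algebras, so that the
   law of a block is determined by its values on singletons. *)
Definition iid_uniform_blocks (L : nat) (d : measure_display)
    (T : measurableType d) (R : realType) (P : probability T R)
    (b : int -> {RV P >-> L.-tuple bool}) : Prop :=
  mutually_independent P b /\
  (forall (n : int) (x : L.-tuple bool),
     distribution P (b n) [set x] = ((2 ^+ L)^-1)%:E).

Arguments iid_uniform_blocks {L d T R} P b.

Definition recurs_at (L : nat) (b : int -> L.-tuple bool) (n : int) : pred nat :=
  fun m => (0 < m)%N && (b (n - m%:Z) == b n).

(* Takes the value 0 on the null event where the block never occurred before. *)
Definition recurrence_time (L : nat) (b : int -> L.-tuple bool) (n : int) : nat :=
  if pselect (exists m, recurs_at b n m) is left h then ex_minn h else 0%N.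

Definition gfun (R : realType) (i : nat) : R :=
  (ln 2)^-1 * \sum_(1 <= j < i) j%:R^-1.

Definition Avar (L : nat) (d : measure_display) (T : measurableType d)
    (b : int -> {mfun T >-> L.-tuple bool}) (n : nat) : T -> nat :=
  fun t => recurrence_time (fun k => b k t) n%:Z.

Definition Xvar (R : realType) (L : nat) (d : measure_display)
    (T : measurableType d) (b : int -> {mfun T >-> L.-tuple bool}) (n : nat) :
    T -> R :=
  fun t => gfun R (Avar b n t).

Lemma measurable_tuple_bool_set1 (L : nat) (x : L.-tuple bool) :
  measurable [set x].
Proof.
have -> : [set x] = \bigcap_(i in [set: 'I_L])
    ((fun y : L.-tuple bool => tnth y i) @^-1` [set tnth x i]).
  apply/seteqP; split => [y -> //|y /= xy].
  by apply: eq_from_tnth => i; exact: xy.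
apply: fin_bigcap_measurable => // i _.
by rewrite -[X in measurable X]setTI; exact: measurable_tnth.
Qed.

Lemma measurable_recurs_at (L : nat) (d : measure_display)
    (T : measurableType d) (b : int -> {mfun T >-> L.-tuple bool}) (n m : nat) :
  measurable [set t | recurs_at (fun k => b k t) n%:Z m].
Proof.
have [m0|m0] := boolP (0 < m)%N; last first.
  have -> // : [set t | recurs_at (fun k => b k t) n%:Z m] = set0.
  by apply/seteqP; split => t //=; rewrite /recurs_at (negbTE m0).
have -> : [set t | recurs_at (fun k => b k t) n%:Z m] =
    \bigcup_(x in [set: L.-tuple bool])
      ((b (n%:Z - m%:Z) @^-1` [set x]) `&` (b n%:Z @^-1` [set x])).
  apply/seteqP; split => [t /= /andP[_ /eqP e]|t [x _ [/= e1 e2]]].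
    by exists (b n%:Z t).
  by rewrite /= /recurs_at m0 e1 e2 eqxx.
apply: fin_bigcup_measurable => // x _.
by apply: measurableI; apply: measurable_funPTI;
  exact: measurable_tuple_bool_set1.
Qed.

Lemma measurable_Avar (L : nat) (d : measure_display) (T : measurableType d)
    (b : int -> {mfun T >-> L.-tuple bool}) (n : nat) :
  measurable_fun [set: T] (Avar b n).
Proof.
pose E m := [set t | recurs_at (fun k => b k t) n%:Z m].
have mE m : measurable (E m) by exact: measurable_recurs_at.
have mS k : measurable [set t | Avar b n t = k.+1].
  have -> : [set t | Avar b n t = k.+1] =
      E k.+1 `&` \bigcap_(m in [set m | (m < k.+1)%N]) ~` E m.
    apply/seteqP; split => t /=; rewrite /Avar /recurrence_time.
      case: pselect => // h; case: ex_minnP => m Hm minm mk; subst m.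
      split => // m /= mk /minm; rewrite leqNgt => /negP; exact.
    move=> [Ek minE]; case: pselect => [h|]; last by case; exists k.+1.
    case: ex_minnP => m Hm minm; apply/eqP; rewrite eqn_leq minm //= leqNgt.
    by apply/negP => mk; exact: (minE m mk).
  apply: measurableI => //; apply: bigcap_measurable; first by exists 0%N.
  by move=> m _; exact: measurableC.
have m1 k : measurable [set t | Avar b n t = k].
  case: k => [|k]; last exact: mS.
  have -> : [set t | Avar b n t = 0%N] =
      ~` \bigcup_(k in [set: nat]) [set t | Avar b n t = k.+1].
    apply/seteqP; split => t /=; first by move=> t0 [k _ /=]; rewrite t0.
    by case e: (Avar b n t) => [|k] // nk; exfalso; apply: nk; exists k.
  by apply: measurableC; apply: bigcup_measurable => k _; exact: mS.
move=> _ B _; rewrite setTI.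
have -> : Avar b n @^-1` B = \bigcup_(k in B) [set t | Avar b n t = k].
  apply/seteqP; split => [t Bt|t [k Bk] /= Ak]; first by exists (Avar b n t).
  by rewrite /preimage /= Ak.
by apply: bigcup_measurable => k _; exact: m1.
Qed.

Lemma measurable_Xvar (R : realType) (L : nat) (d : measure_display)
    (T : measurableType d) (b : int -> {mfun T >-> L.-tuple bool}) (n : nat) :
  measurable_fun [set: T] (Xvar R b n).
Proof. by apply: (measurableT_comp _ (measurable_Avar b n)). Qed.

HB.instance Definition _ (R : realType) (L : nat) (d : measure_display)
    (T : measurableType d) (b : int -> {mfun T >-> L.-tuple bool}) (n : nat) :=
  isMeasurableFun.Build _ _ T R (Xvar R b n) (measurable_Xvar b n).

(* Under [iid_uniform_blocks] the mean of [Xvar R b n] is the same for all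
   [n >= 1]. *)
Definition mu_X (R : realType) (L : nat) (d : measure_display)
    (T : measurableType d) (P : probability T R)
    (b : int -> {RV P >-> L.-tuple bool}) : R :=
  fine ('E_P[Xvar R b 1])%E.

Arguments mu_X {R L d T} P b.

Definition normalized_sum (R : realType) (L : nat) (d : measure_display)
    (T : measurableType d) (P : probability T R)
    (b : int -> {RV P >-> L.-tuple bool}) (K : nat) : T -> R :=
  fun t => (Num.sqrt K%:R)^-1 * \sum_(1 <= k < K.+1) (Xvar R b k t - mu_X P b).

Arguments normalized_sum {R L d T} P b K.

Lemma measurable_normalized_sum (R : realType) (L : nat) (d : measure_display)
    (T : measurableType d) (P : probability T R)
    (b : int -> {RV P >-> L.-tuple bool}) (K : nat) :
  measurable_fun [set: T] (normalized_sum P b K).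
Proof.
apply: measurable_funM => //; apply: measurable_sum => k.
by apply: measurable_funB => //; exact: measurable_Xvar.
Qed.

HB.instance Definition _ (R : realType) (L : nat) (d : measure_display)
    (T : measurableType d) (P : probability T R)
    (b : int -> {RV P >-> L.-tuple bool}) (K : nat) :=
  isMeasurableFun.Build _ _ T R (normalized_sum P b K)
    (measurable_normalized_sum b K).

Definition tau_X (R : realType) (L : nat) (d : measure_display)
    (T : measurableType d) (P : probability T R)
    (b : int -> {RV P >-> L.-tuple bool}) : R :=
  fine (limn (fun K => 'V_P[normalized_sum P b K])).

Arguments tau_X {R L d T} P b.

(* [normal_prob] takes the standard deviation, and [normal_prob m 0] is the
   uniform law on [0, 1], hence the separate treatment of the variance 0. *)
Definition normal_law (R : realType) (m v : R) :
    probability (measurableTypeR R) R :=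
  if v == 0 then \d_(m : measurableTypeR R) : probability (measurableTypeR R) R
  else normal_prob m (Num.sqrt v) : probability (measurableTypeR R) R.

Definition cvg_in_distribution (d : measure_display) (T : measurableType d)
    (R : realType) (P : probability T R) (S : nat -> {RV P >-> R})
    (nu : probability (measurableTypeR R) R) : Prop :=
  forall f : R -> R, continuous f -> bounded_fun f ->
    (\int[distribution P (S K)]_x (f x)%:E)%E @[K --> \oo] -->
    (\int[nu]_x (f x)%:E)%E.

Arguments cvg_in_distribution {d T R} P S nu.

(* Main.v *)
(* Truncating the look-back at time 0 changes the centred sum by a quantity
   bounded in L^2 uniformly in K, because the recurrence times have geometric
   tails; this leaves sums over finite uniform words.  Cut the word into blocks
   of length q and truncate the look-back at the beginning of the current block:
   the block sums become i.i.d. and bounded.  The part of the gain that is cut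
   off is nonnegative and has covariances that decay geometrically, so its
   variance is O(K / q + 1).  Hence Var / K is Cauchy, its limit tau is the limit
   as q -> oo of the normalized block variances, and the elementary central limit
   theorem for the blocks (a telescoping estimate on the means of cos (t x + s))
   passes to the limit.  Convergence of the means of all cos (t x + s), together
   with tightness, gives convergence in distribution: on [-A, A] a continuous
   function is a continuous function of sin (x / A), hence by Bernstein's theorem
   nearly a trigonometric polynomial that is bounded on the whole line. *)
Require Import Defs.
From HB Require Import structures.
From mathcomp Require Import all_boot all_order all_algebra finmap.
From mathcomp Require Import all_classical all_reals all_analysis.
From mathcomp Require Import measurable_realfun ring lra zify.

Set Implicit Arguments.
Unset Strict Implicit.
Unset Printing Implicit Defensive.

Import Order.TTheory GRing.Theory Num.Theory.
Import numFieldNormedType.Exports.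

Local Open Scope classical_set_scope.
Local Open Scope ring_scope.

(** * Averages over uniform words *)

(** The gain is used through one property: its increments lie between 0 and a constant [c], here the
    inverse of [ln 2]. Looking further back can therefore only raise the gain, by at most [c] times
    the extra distance. This sign makes the part that is cut off nonnegative, so one-sided
    covariance bounds suffice.

    The obstacle is that the cut is not small near the beginning of a block, where almost no past is
    visible. The loss at distance [k] from the beginning of the block has L^2 norm of order
    [gam ^+ k], and its correlation with older losses decays geometrically as well, so each block
    adds only a bounded amount of variance, whatever [q] is.

    Cosines with an arbitrary phase stand in for complex exponentials: the phase carries the
    contribution of the blocks already handled when the next one is averaged, and products of such
    cosines linearize within the same family.

    The limit variance is never computed. Errors have the form [a / sqrt q + K q / sqrt n], where
    [K q] may be arbitrarily large because [n] tends to infinity before [q] does. *)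

Section word_average.
Context {R : realType} {A : finType}.
Hypothesis A0 : (0 < #|A|)%N.
Implicit Types (F G : seq A -> R) (n : nat).

Let N0 : #|A|%:R != 0 :> R.
Proof. by rewrite pnatr_eq0 -lt0n. Qed.

(** Recursion on lists instead of a sum over tuples: conditioning on the first letter is then the
    definition itself, and words can be concatenated and cut without casts between lengths. *)
Fixpoint word_mean n F : R :=
  if n is m.+1 then #|A|%:R^-1 * \sum_(x : A) word_mean m (fun s => F (x :: s))
  else F [::].

Lemma word_mean_le n F G : (forall s, size s = n -> F s <= G s) ->
  word_mean n F <= word_mean n G.
Proof.
elim: n F G => [|n IH] F G FG /=; first exact: FG.
rewrite ler_wpM2l// ler_sum// => x _; apply: IH => s sn.
by apply: FG => /=; rewrite sn.
Qed.

Lemma word_mean_eq n F G : (forall s, size s = n -> F s = G s) ->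
  word_mean n F = word_mean n G.
Proof. by move=> FG; apply/eqP; rewrite eq_le !word_mean_le// => s /FG ->. Qed.

Lemma word_meanD n F G : word_mean n (fun s => F s + G s) = word_mean n F + word_mean n G.
Proof.
elim: n F G => [//|n IH] F G /=; rewrite -mulrDr -big_split/=.
by under eq_bigr do rewrite IH.
Qed.

Lemma word_meanZ n c F : word_mean n (fun s => c * F s) = c * word_mean n F.
Proof.
elim: n F => [//|n IH] F /=; rewrite mulrCA; congr (_ * _).
by rewrite mulr_sumr; under eq_bigr do rewrite IH.
Qed.

Lemma word_meanZr n c F : word_mean n (fun s => F s * c) = word_mean n F * c.
Proof. by rewrite mulrC -word_meanZ; apply: word_mean_eq => s _; rewrite mulrC. Qed.

Lemma word_meanN n F : word_mean n (fun s => - F s) = - word_mean n F.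
Proof. by rewrite -mulN1r -word_meanZ; apply: word_mean_eq => s _; rewrite mulN1r. Qed.

Lemma word_meanB n F G : word_mean n (fun s => F s - G s) = word_mean n F - word_mean n G.
Proof. by rewrite word_meanD word_meanN. Qed.

Lemma word_mean_cst n c : word_mean n (fun=> c) = c.
Proof.
elim: n => [//|n IH] /=; under eq_bigr do rewrite IH.
by rewrite sumr_const -[c *+ _]mulr_natl mulKf.
Qed.

Lemma word_mean_ge0 n F : (forall s, size s = n -> 0 <= F s) -> 0 <= word_mean n F.
Proof. by move=> F0; rewrite -[0](word_mean_cst n) word_mean_le. Qed.

Lemma word_mean_sum (I : finType) n (F : I -> seq A -> R) :
  word_mean n (fun s => \sum_i F i s) = \sum_i word_mean n (F i).
Proof.
elim: n F => [//|n IH] F /=; under eq_bigr do rewrite IH.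
by rewrite exchange_big/= mulr_sumr.
Qed.

Lemma word_mean_cat m n F :
  word_mean (m + n) F = word_mean m (fun u => word_mean n (fun v => F (u ++ v))).
Proof. by elim: m F => [//|m IH] F; rewrite addSn /=; under eq_bigr do rewrite IH. Qed.

Lemma word_mean_swap m n (F : seq A -> seq A -> R) :
  word_mean m (fun u => word_mean n (fun v => F u v)) =
  word_mean n (fun v => word_mean m (fun u => F u v)).
Proof.
elim: m F => [//|m IH] F /=; under eq_bigr do rewrite IH.
by rewrite word_meanZ word_mean_sum.
Qed.

Lemma ler_norm_word_mean n F : `|word_mean n F| <= word_mean n (fun s => `|F s|).
Proof.
by rewrite ler_norml -word_meanN !word_mean_le// => s _; rewrite ?ler_norm// lerNl ler_normr lexx orbT.
Qed.

Definition word_var n F := word_mean n (fun s => (F s - word_mean n F) ^+ 2).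

Lemma word_varE n F : word_var n F = word_mean n (fun s => F s ^+ 2) - word_mean n F ^+ 2.
Proof.
rewrite /word_var; set a := word_mean n F.
transitivity (word_mean n (fun s => F s ^+ 2 - (2 * a * F s - a ^+ 2))).
  by apply: word_mean_eq => s _; ring.
by rewrite !word_meanB word_meanZ word_mean_cst -/a; ring.
Qed.

Lemma word_var_ge0 n F : 0 <= word_var n F.
Proof. by apply: word_mean_ge0 => s _; rewrite sqr_ge0. Qed.

Let rho : R := 1 - #|A|%:R^-1.

(** Step on the first letter: a letter other than [x] is discarded, and [rho] is the price of one
    such miss. The geometric estimates on [index] come from iterating this. *)
Lemma word_mean_first_letter n (x : A) (c : R) F G :
  (forall s, F (x :: s) = c) ->
  (forall y s, y != x -> F (y :: s) = G s) ->
  word_mean n.+1 F = #|A|%:R^-1 * c + rho * word_mean n G.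
Proof.
move=> Fx Fy; rewrite /= (bigD1 x)//=.
rewrite (word_mean_eq (fun s _ => Fx s)) word_mean_cst mulrDr; congr (_ + _).
rewrite (eq_bigr (fun=> word_mean n G)); last first.
  by move=> y yx; apply: word_mean_eq => s _; exact: Fy.
rewrite sumr_const -[X in _ * X]mulr_natl mulrA; congr (_ * _).
have -> : #|[pred i | i != x]| = #|A|.-1 by rewrite (cardC1 x).
by rewrite -subn1 natrB// mulrBr mulVf// mulr1.
Qed.

Lemma word_mean_index_rec n (x : A) (f : nat -> R) :
  word_mean n.+1 (fun s => f (index x s)) =
  #|A|%:R^-1 * f 0%N + rho * word_mean n (fun s => f (index x s).+1).
Proof.
apply: (@word_mean_first_letter _ x) => [s|y s /negbTE yx]; first by rewrite /= eqxx.
by rewrite /= yx.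
Qed.

Let rho_ge0 : 0 <= rho.
Proof. by rewrite subr_ge0 invf_le1 ?ler1n// ltr0n. Qed.

Let rhoN : rho * #|A|%:R = #|A|%:R - 1.
Proof. by rewrite mulrBl mulVf// mul1r. Qed.

Let invN_ge0 : 0 <= #|A|%:R^-1 :> R.
Proof. by rewrite invr_ge0. Qed.

(** [index + 1] is a geometric variable capped at [n + 1]; the bound is the mean without the cap, a
    fixed point of the recursion. *)
Lemma word_mean_index1_le n (x : A) :
  word_mean n (fun s => (index x s).+1%:R) <= #|A|%:R.
Proof.
elim: n => [|n IH]; first by rewrite /= ler1n.
rewrite (word_mean_index_rec n x (fun i => i.+1%:R)) mulr1 -/rho.
rewrite (@word_mean_eq n _ (fun s => (index x s).+1%:R + 1)); last first.
  by move=> s _; rewrite -[in LHS]natr1.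
rewrite word_meanD word_mean_cst.
have := ler_wpM2l rho_ge0 IH; rewrite rhoN mulrDr mulr1 /rho; lra.
Qed.

(** The uncapped geometric law has second moment [2 N^2 - N] with [N = #|A|]; the rounder bound
    [2 N^2] is still preserved by the recursion. *)
Lemma word_mean_index1_sqr_le n (x : A) :
  word_mean n (fun s => (index x s).+1%:R ^+ 2) <= 2 * #|A|%:R ^+ 2.
Proof.
have A1 : 1 <= #|A|%:R :> R by rewrite ler1n.
elim: n => [|n IH]; first by rewrite /=; nra.
rewrite (word_mean_index_rec n x (fun i => i.+1%:R ^+ 2)) expr1n mulr1 -/rho.
rewrite (@word_mean_eq n _ (fun s => (index x s).+1%:R ^+ 2 +
  (2 * (index x s).+1%:R + 1))); last first.
  by move=> s _; rewrite -[in LHS]natr1; ring.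
rewrite !word_meanD word_meanZ word_mean_cst.
have H1 := ler_wpM2l rho_ge0 IH.
have H2 := ler_wpM2l rho_ge0 (word_mean_index1_le n x).
have H3 : rho * (2 * #|A|%:R ^+ 2) = 2 * (#|A|%:R - 1) * #|A|%:R.
  by rewrite -rhoN; ring.
have H4 : rho + #|A|%:R^-1 = 1 by rewrite /rho subrK.
rewrite H3 in H1; rewrite rhoN in H2; lra.
Qed.

(** The overshoot past [i] is nonzero only if the first [i] letters all miss [x]; each miss
    contributes a factor [rho], after which the count starts afresh. *)
Lemma word_mean_index_excess_sqr_le n i (x : A) :
  word_mean n (fun s => (index x s - i)%:R ^+ 2) <= 2 * #|A|%:R ^+ 2 * rho ^+ i.
Proof.
elim: i n => [|i IH] n.
  rewrite mulr1; apply: le_trans (word_mean_index1_sqr_le n x); apply: word_mean_le => s _.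
  by rewrite subn0 lerXn2r ?nnegrE// ler_nat.
case: n => [|n].
  by rewrite /= sub0n expr0n/= !mulr_ge0// exprn_ge0.
rewrite (word_mean_index_rec n x (fun j => (j - i.+1)%:R ^+ 2)) sub0n expr0n/= mulr0 add0r.
rewrite [rho ^+ _]exprS mulrCA ler_wpM2l//.
Qed.

(* memorylessness of the geometric law *)
Lemma word_mean_index_cat m (x : A) (w : seq A) :
  word_mean m (fun u => (index x (u ++ w) - m)%:R) = rho ^+ m * (index x w)%:R.
Proof.
elim: m => [|m IH]; first by rewrite /= subn0 mul1r.
rewrite (@word_mean_first_letter _ x 0 _ (fun u => (index x (u ++ w) - m)%:R)).
- by rewrite mulr0 add0r IH exprS mulrA.
- by move=> s /=; rewrite eqxx sub0n.
- by move=> y s /negbTE /= ->.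
Qed.
Lemma word_mean_first_le n F B :
  (forall x, word_mean n (fun s => F (x :: s)) <= B) -> word_mean n.+1 F <= B.
Proof.
move=> FB; rewrite -[B](word_mean_cst 1) /= ler_wpM2l//.
by apply: ler_sum => x _; exact: FB.
Qed.

Lemma word_mean_behead n F : word_mean n.+1 (fun s => F (behead s)) = word_mean n F.
Proof.
rewrite /= -[RHS](word_mean_cst 1) /=; congr (_ * _); apply: eq_bigr => x _.
Qed.
End word_average.
Arguments word_mean : simpl never.

(** * Truncated recurrence times *)

Section index_take.
Context {A : eqType}.
Implicit Types (x : A) (s u v : seq A).

Lemma index_cat_le x u v : (index x u <= index x (u ++ v))%N.
Proof.
by rewrite index_cat; case: ifP => // _; rewrite (leq_trans (index_size _ _))// leq_addr.
Qed.

Lemma index_cat_sub x u v :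
  (index x (u ++ v) - index x u = index x (u ++ v) - size u)%N.
Proof.
rewrite index_cat; case: ifPn => [xu|xu]; last by rewrite (memNindex xu).
by rewrite subnn; apply/esym/eqP; rewrite subn_eq0 index_size.
Qed.

Lemma index_take_le x i s : (index x (take i s) <= index x s)%N.
Proof. by rewrite -[in leqRHS](cat_take_drop i s) index_cat_le. Qed.

(** If [x] is among the first [i] letters, or [s] has at most [i] letters, both sides vanish;
    otherwise the truncated index equals [i]. *)
Lemma index_take_sub x i s :
  (index x s - index x (take i s) = index x s - i)%N.
Proof.
have [si|si] := leqP (size s) i.
  by rewrite take_oversize// subnn; apply/esym/eqP;
     rewrite subn_eq0 (leq_trans (index_size _ _)).
rewrite -[in X in (X - _)%N](cat_take_drop i s) index_cat_sub cat_take_drop.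
by rewrite size_take si.
Qed.
End index_take.

Section suffix_sum.
Context {R : realType} {A : finType}.
Implicit Types (f : seq A -> R).

(** With the newest letter at the head, the nonempty suffixes of a word are its histories at
    successive times, so this is the sum of [f] over time. *)
Fixpoint suffix_sum f s : R := if s is _ :: s' then f s + suffix_sum f s' else 0.

Lemma suffix_sumD f1 f2 s :
  suffix_sum (fun s => f1 s + f2 s) s = suffix_sum f1 s + suffix_sum f2 s.
Proof. by elim: s => [|x s /= ->]; rewrite ?addr0//; ring. Qed.
End suffix_sum.

(** * Variance of the gain lost by truncating the look-back *)

Section recurrence_excess.
Context {R : realType} {A : finType}.
Hypothesis A1 : (1 < #|A|)%N.
Variables (h : nat -> R) (c : R).
Hypothesis h_incr : forall n, 0 <= h n.+1 - h n <= c.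

Let A0 : (0 < #|A|)%N. Proof. exact: ltnW. Qed.
Let N : R := #|A|%:R.
Let rho : R := 1 - #|A|%:R^-1.
(** Second moments of the lost gain decay like powers of [rho]; [gam] is the corresponding rate for
    L^2 norms. *)
Let gam : R := Num.sqrt rho.

Let N_gt0 : 0 < N. Proof. by rewrite ltr0n. Qed.

Let rho_gt0 : 0 < rho.
Proof. by rewrite subr_gt0 invf_lt1 ?ltr1n// ltr0n. Qed.

Let rho_lt1 : rho < 1.
Proof. by rewrite ltrBlDr ltrDl invr_gt0 ltr0n. Qed.

Let gam2 : gam ^+ 2 = rho. Proof. by rewrite sqr_sqrtr// ltW. Qed.

Let gam_gt0 : 0 < gam. Proof. by rewrite sqrtr_gt0. Qed.

Let gam_lt1 : gam < 1.
Proof. by rewrite -(@ltr_pXn2r _ 2)// ?nnegrE// ?ltW// gam2 expr1n. Qed.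

Let c_ge0 : 0 <= c.
Proof. by have /andP[] := h_incr 0; exact: le_trans. Qed.

Lemma increments_le a b : (b <= a)%N -> 0 <= h a - h b <= c * (a - b)%:R.
Proof.
move=> /subnK <-; rewrite addnK; elim: (a - b)%N => [|k /andP[IH1 IH2]].
  by rewrite add0n subrr mulr0 lexx.
have /andP[H1 H2] := h_incr (k + b); rewrite addSn -natr1 mulrDr mulr1; lra.
Qed.

Variable off : nat -> nat.

(* Words are read from their newest letter, so that [index x s] is the recurrence
   time of [x] after the past [s], minus one, truncated at [size s].  [off n] is
   the number of past letters that the approximation at time [n] looks at. *)
Definition excess (s : seq A) : R :=
  if s is x :: s' then h (index x s') - h (index x (take (off (size s')) s'))
  else 0.

Lemma excess_ge0 s : 0 <= excess s.
Proof. by case: s => [//|x s] /=; have /andP[] := increments_le (index_take_le x (off (size s)) s). Qed.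

Lemma excess_le x s : excess (x :: s) <= c * (index x s - off (size s))%:R.
Proof.
have /andP[_] := increments_le (index_take_le x (off (size s)) s).
by rewrite index_take_sub.
Qed.

(** For a fixed newest letter the loss is at most [c] times the overshoot of its index past [off n],
    whose second moment carries [rho ^+ off n]. *)
Lemma word_mean_excess_sqr n : word_mean n.+1 (fun s => excess s ^+ 2) <=
  2 * c ^+ 2 * N ^+ 2 * gam ^+ off n ^+ 2.
Proof.
apply: (word_mean_first_le A0) => x.
apply: (@le_trans _ _ (word_mean n (fun s => c ^+ 2 * (index x s - off n)%:R ^+ 2))).
  apply: word_mean_le => s sn; rewrite -exprMn lerXn2r ?nnegrE ?mulr_ge0//.
    exact: (excess_ge0 (x :: s)).
  by rewrite -[in leRHS]sn; exact: excess_le.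
rewrite word_meanZ; have H := @word_mean_index_excess_sqr_le R A A0 n (off n) x.
have {}H := ler_wpM2l (sqr_ge0 c) H; apply: le_trans H _.
by rewrite -/rho -/N -gam2 -!exprM mulnC; rewrite le_eqVlt; apply/orP; left; apply/eqP; ring.
Qed.

(** The part of the loss that is visible when the past is cut to [u]. The parameter [m] is the
    length of the full past, so that the look-back [off m] agrees with that of [excess] on the uncut
    word. *)
Definition recent_excess m (s : seq A) : R :=
  if s is x :: u then h (index x u) - h (index x (take (off m) u)) else 0.

(** If the look-back ends inside [u], the truncated terms coincide and only the full indices differ.
    If it reaches beyond [u], the recent part is zero and the truncated index is at least
    [index x u]. *)
Lemma excess_split x u w :
  0 <= excess (x :: u ++ w) - recent_excess (size (u ++ w)) (x :: u) <=
  c * (index x (u ++ w) - size u)%:R.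
Proof.
rewrite /=; set i := off _.
have H0 := increments_le (index_cat_le x u w).
rewrite index_cat_sub in H0.
have H1 := increments_le (index_take_le x i (u ++ w)).
have [iu|ui] := leqP i (size u).
  by rewrite takel_cat//; move: H0; lra.
rewrite (take_oversize (ltnW ui)).
have : 0 <= h (index x (take i (u ++ w))) - h (index x u).
  rewrite take_cat ltnNge (ltnW ui)/=.
  by have /andP[] := increments_le (index_cat_le x u (take (i - size u) w)).
by move: H0 H1; lra.
Qed.

(* [recent_excess] depends on the first [m.+1] letters only, so it is independent of
   the older [excess]; what remains is a product of nonnegative terms *)
Lemma excess_cov m n :
  word_mean (m.+1 + n.+1) (fun s => excess s * excess (drop m.+1 s)) -
  word_mean (m.+1 + n.+1) excess * word_mean n.+1 excess <=
  2 * c ^+ 2 * N ^+ 2 * gam ^+ off n * rho ^+ m.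
Proof.
pose r (u : seq A) := recent_excess (m + n.+1) u.
pose d u w := excess (u ++ w) - r u.
have -> : word_mean (m.+1 + n.+1) (fun s => excess s * excess (drop m.+1 s)) =
   word_mean m.+1 r * word_mean n.+1 excess +
   word_mean m.+1 (fun u => word_mean n.+1 (fun w => d u w * excess w)).
  rewrite word_mean_cat -word_meanZr -word_meanD; apply: word_mean_eq => u um.
  rewrite -word_meanZ -word_meanD; apply: word_mean_eq => w wn.
  by rewrite drop_size_cat// /d; ring.
have -> : word_mean (m.+1 + n.+1) excess =
   word_mean m.+1 r + word_mean m.+1 (fun u => word_mean n.+1 (fun w => d u w)).
  rewrite word_mean_cat -word_meanD; apply: word_mean_eq => u um.
  rewrite -[X in X + _](word_mean_cst A0 n.+1) -word_meanD; apply: word_mean_eq => w wn.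
  by rewrite /d addrC subrK.
have d_bnd x u w : size u = m -> size w = n.+1 ->
    0 <= d (x :: u) w <= c * (index x (u ++ w) - m)%:R.
  move=> um wn; have := excess_split x u w.
  by rewrite size_cat um wn.
have d0 : 0 <= word_mean m.+1 (fun u => word_mean n.+1 (fun w => d u w)).
  apply: word_mean_ge0 => // -[//|x u] [um]; apply: word_mean_ge0 => // w wn.
  by have /andP[] := d_bnd x u w um wn.
have e0 : 0 <= word_mean n.+1 excess by apply: word_mean_ge0 => // s _; exact: excess_ge0.
have {d0 e0} := mulr_ge0 d0 e0; rewrite mulrDl.
suff : word_mean m.+1 (fun u => word_mean n.+1 (fun w => d u w * excess w)) <=
    2 * c ^+ 2 * N ^+ 2 * gam ^+ off n * rho ^+ m by lra.
apply: (word_mean_first_le A0) => x.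
apply: (@le_trans _ _ (word_mean m (fun u => word_mean n.+1 (fun w =>
   c * (index x (u ++ w) - m)%:R * excess w)))).
  apply: word_mean_le => u um; apply: word_mean_le => w wn.
  rewrite ler_wpM2r ?excess_ge0//.
  by have /andP[] := d_bnd x u w um wn.
(* Averaging over the recent letters [u] comes first: by memorylessness the overshoot past them
   becomes [rho ^+ m] times the index of [x] in the older word [w]. *)
rewrite word_mean_swap.
under word_mean_eq => w _ do rewrite word_meanZr word_meanZ word_mean_index_cat//.
apply: (word_mean_first_le A0) => y.
(* Weighted form of [2 a b <= a^2 / g + g b^2]. The second moment of [a] is of order [g^2] and that
   of [b] of order 1, so the weight [g] makes both terms of order [g]. *)
pose K := c ^+ 2 * rho ^+ m / 2; set g := gam ^+ off n.
have g0 : 0 < g by rewrite exprn_gt0.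
apply: (@le_trans _ _ (word_mean n (fun v => K * (g^-1 * (index y v - off n)%:R ^+ 2
   + g * (index x v).+1%:R ^+ 2)))).
  apply: word_mean_le => v vn.
  have := excess_le y v; rewrite /= vn; set a := (_ - off n)%:R => ea.
  have e0 := excess_ge0 (y :: v); rewrite /= vn in e0.
  have xv : (index x (y :: v))%:R <= (index x v).+1%:R :> R.
    by rewrite ler_nat /=; case: ifP.
  rewrite /= in xv.
  set b := (index x v).+1%:R in xv *.
  apply: (@le_trans _ _ (c * (rho ^+ m * b) * (c * a))).
    apply: ler_pM; rewrite ?mulr_ge0 ?exprn_ge0 ?(ltW rho_gt0)//.
      by rewrite ler_wpM2l// ler_wpM2l// exprn_ge0// ltW.
  rewrite [leLHS](_ : _ = K * (2 * (a * b))); last by rewrite /K; field.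
  rewrite ler_wpM2l ?divr_ge0 ?mulr_ge0 ?sqr_ge0 ?exprn_ge0 ?(ltW rho_gt0)//.
  have -> : g^-1 * a ^+ 2 + g * b ^+ 2 = 2 * (a * b) + g^-1 * (a - g * b) ^+ 2.
    by field; rewrite gt_eqF.
  by rewrite lerDl mulr_ge0 ?sqr_ge0// invr_ge0 ltW.
rewrite word_meanZ word_meanD !word_meanZ.
have H1 := @word_mean_index_excess_sqr_le R A A0 n (off n) y.
have H2 := @word_mean_index1_sqr_le R A A0 n x.
have {}H1 : g^-1 * word_mean n (fun v => (index y v - off n)%:R ^+ 2) <= 2 * N ^+ 2 * g.
  have -> : 2 * N ^+ 2 * g = g^-1 * (2 * N ^+ 2 * rho ^+ off n).
    by rewrite -gam2 -exprM mulnC exprM -/g; field; rewrite gt_eqF.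
  by rewrite ler_wpM2l// invr_ge0 ltW.
have {}H2 : g * word_mean n (fun v => (index x v).+1%:R ^+ 2) <= 2 * N ^+ 2 * g.
  by rewrite mulrC ler_wpM2r// ltW.
apply: (@le_trans _ _ (K * (2 * N ^+ 2 * g + 2 * N ^+ 2 * g))).
  by rewrite ler_wpM2l ?lerD// divr_ge0 ?mulr_ge0 ?sqr_ge0 ?exprn_ge0 ?(ltW rho_gt0).
by rewrite /K; rewrite le_eqVlt; apply/orP; left; apply/eqP; field.
Qed.

Let D := suffix_sum excess.

(** The sum over [k < n] of [rho ^+ (n - 1 - k) * gam ^+ off k]: up to a constant, a bound for the
    covariances of the newest loss with all older ones. *)
Fixpoint geom_conv (n : nat) : R :=
  if n is k.+1 then rho * geom_conv k + gam ^+ off k else 0.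

Let kappa : R := 2 * c ^+ 2 * N ^+ 2.

Let kappa_ge0 : 0 <= kappa. Proof. by rewrite !mulr_ge0 ?sqr_ge0. Qed.

Lemma word_mean_suffix_sumS n (f : seq A -> R) :
  word_mean n.+1 (suffix_sum f) = word_mean n.+1 f + word_mean n (suffix_sum f).
Proof.
rewrite -(word_mean_behead A0 n (suffix_sum f)) -word_meanD.
by apply: word_mean_eq => -[|x s].
Qed.

(** Peeling the newest term off [D] leaves the same covariance at lag [m + 1], whose additional
    factor [rho] produces the recursion of [geom_conv]. *)
Lemma excess_sum_cov m n :
  word_mean (m.+1 + n) (fun s => excess s * D (drop m.+1 s)) -
  word_mean (m.+1 + n) excess * word_mean n D <= kappa * rho ^+ m * geom_conv n.
Proof.
elim: n m => [|n IH] m.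
  rewrite [word_mean 0 D](_ : _ = 0)// !mulr0 subr0 -[leRHS](word_mean_cst A0 (m.+1 + 0)).
  by apply: word_mean_le => s sn; rewrite drop_oversize ?sn ?addn0//= mulr0.
have -> : word_mean (m.+1 + n.+1) (fun s => excess s * D (drop m.+1 s)) =
  word_mean (m.+1 + n.+1) (fun s => excess s * excess (drop m.+1 s)) +
  word_mean (m.+2 + n) (fun s => excess s * D (drop m.+2 s)).
  rewrite -addSnnS -word_meanD; apply: word_mean_eq => s sn.
  rewrite -mulrDr (_ : drop m.+2 s = drop 1 (drop m.+1 s)); last by rewrite drop_drop.
  case: (drop m.+1 s) (size_drop m.+1 s) => [|y v _]; first by rewrite sn addSnnS addKn.
  by rewrite /= drop0.
rewrite word_mean_suffix_sumS mulrDr.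
have := IH m.+1; have := excess_cov m n.
rewrite [in word_mean (m.+2 + n) excess]addSnnS -/kappa -/D exprS /=; lra.
Qed.

(** Variance of a sum: the older variance, plus the variance of the newest loss, plus twice the
    covariance. Since [gam < 1], the square of [gam ^+ off n] is relaxed to its first power to match
    [geom_conv]. *)
Lemma word_var_excess_sumS n : word_var n.+1 D <= word_var n D +
  kappa * (gam ^+ off n + 2 * geom_conv n).
Proof.
have H1 := excess_sum_cov 0 n; have H2 := word_mean_excess_sqr n.
rewrite !(word_varE A0) word_mean_suffix_sumS -/D.
rewrite (@word_mean_eq _ _ n.+1 _ (fun s => excess s ^+ 2 +
  (2 * (excess s * D (behead s)) + (fun s => D s ^+ 2) (behead s)))); last first.
  by move=> [|x s] _ /=; rewrite /D /=; ring.
rewrite !word_meanD word_meanZ (word_mean_behead A0 n (fun s => D s ^+ 2)) -/D.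
rewrite expr0 mulr1 add1n in H1.
rewrite (@word_mean_eq _ _ n.+1 _ (fun s => excess s * D (behead s))) in H1; last first.
  by move=> s _; rewrite drop1.
have := sqr_ge0 (word_mean n.+1 excess).
have : gam ^+ off n ^+ 2 <= gam ^+ off n.
  by rewrite expr2 ler_piMr ?exprn_ge0 ?exprn_ile1 ?ltW.
move=> /(ler_wpM2l kappa_ge0).
move: H1 H2; rewrite -/kappa; lra.
Qed.

Lemma word_var_excess_sum n :
  word_var n D <= kappa * (1 + 2 * N) * \sum_(k < n) gam ^+ off k.
Proof.
(* The subtracted multiple of [geom_conv] is a potential: as [1 - rho = 1 / N], its change at each
   step pays exactly for the covariance term [2 * kappa * geom_conv n]. *)
suff : word_var n D <= kappa * (1 + 2 * N) * \sum_(k < n) gam ^+ off k -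
    2 * N * kappa * geom_conv n /\ 0 <= geom_conv n.
  by move=> [H G]; apply: le_trans H _; rewrite lerBlDr lerDl !mulr_ge0 // ltW.
elim: n => [|n [IH G]].
  by rewrite big_ord0 /word_var /word_mean /= subrr expr0n !mulr0 subrr.
split; last first.
  by rewrite /= addr_ge0 ?mulr_ge0 ?exprn_ge0// ltW.
apply: le_trans (word_var_excess_sumS n) _; rewrite big_ord_recr/=.
have -> : rho = 1 - N^-1 by [].
rewrite (_ : _ - _ * (_ + _) = kappa * (1 + 2 * N) * (\sum_(i < n) gam ^+ off i) -
   2 * N * kappa * geom_conv n + kappa * (gam ^+ off n + 2 * geom_conv n)); last first.
  by field; rewrite gt_eqF.
by rewrite lerD2r.
Qed.

End recurrence_excess.

Lemma sum_expr_modn_le (R : realType) (g : R) q n : 0 <= g -> (0 < q)%N ->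
  (1 - g) * \sum_(k < n) g ^+ (k %% q) <= (n %/ q)%:R + 1.
Proof.
(* With [g ^+ (n %% q)] subtracted the bound telescopes inside a period; when the remainder returns
   to 0, the quotient grows by 1 and covers the reset. *)
move=> g0 q0; suff : (1 - g) * \sum_(k < n) g ^+ (k %% q) <=
    (n %/ q)%:R + 1 - g ^+ (n %% q).
  by move=> /le_trans; apply; rewrite gerBl exprn_ge0.
elim: n => [|n IH]; first by rewrite big_ord0 mulr0 div0n mod0n add0r subrr.
rewrite big_ord_recr/= mulrDr; apply: le_trans (lerD IH (lexx _)) _.
have nq := ltn_pmod n q0.
have [nq1|nq1] := ltnP (n %% q).+1 q.
  have e : n.+1 = (n %/ q * q + (n %% q).+1)%N by rewrite addnS -divn_eq.
  rewrite [in leRHS]e divnMDl// modnMDl (modn_small nq1) (divn_small nq1) addn0 exprS.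
  by rewrite le_eqVlt; apply/orP; left; apply/eqP; ring.
have e : n.+1 = ((n %/ q).+1 * q)%N.
  have eq : (n %% q).+1 = q by apply/eqP; rewrite eqn_leq nq nq1.
  by rewrite mulSn {1}(divn_eq n q) -addnS eq addnC.
rewrite [in leRHS]e mulnK// modnMl expr0 -natr1.
have : 0 <= g ^+ (n %% q).+1 by rewrite exprn_ge0.
rewrite exprS; lra.
Qed.

(** * Trigonometric estimates and a double limit *)

Section trig_estimates.
Context {R : realType}.
Implicit Types x y : R.

Lemma ler_dist_derive1 (f f' : R -> R) x y (k : R) :
  (forall z, is_derive z (1 : R) f (f' z)) -> (forall z, `|f' z| <= k) ->
  `|f x - f y| <= k * `|x - y|.
Proof.
move=> df f'k; wlog xy : x y / y <= x.
  move=> H; have [/H//|/ltW/H] := leP y x.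
  by rewrite distrC (distrC x).
have cf : {within `[y, x], continuous f}.
  apply: derivable_within_continuous => z _.
  by have [] := df z.
have [z _ ->] := MVT_segment xy (fun z _ => df z) cf.
by rewrite normrM ler_wpM2r.
Qed.

Lemma ler_dist_cos x y : `|cos x - cos y| <= `|x - y|.
Proof.
rewrite -[leRHS]mul1r; apply: (ler_dist_derive1 _ _ (@is_derive_cos R)).
by move=> z; rewrite normrN sin_max.
Qed.

Lemma ler_norm_sin x : `|sin x| <= `|x|.
Proof.
have := ler_dist_derive1 x 0 (@is_derive_sin R) (@cos_max R).
by rewrite sin0 !subr0 mul1r.
Qed.

Lemma cos_half x : 1 - cos x = 2 * sin (x / 2) ^+ 2.
Proof.
have e : x = (x / 2) *+ 2 by rewrite -mulr_natr divfK.
by rewrite {1}e cos_mulr2n sin2cos2 -[_ *+ 2]mulr_natl; ring.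
Qed.

Lemma cos_sub1_le x : `|cos x - 1| <= x ^+ 2 / 2.
Proof.
have s2 : sin (x / 2) ^+ 2 <= (x / 2) ^+ 2.
  rewrite -(real_normK (num_real (sin _))) -(real_normK (num_real (x / 2))).
  by rewrite lerXn2r ?nnegrE// ler_norm_sin.
rewrite distrC cos_half ger0_norm; last by rewrite mulr_ge0 ?sqr_ge0.
by move: s2; lra.
Qed.

(** One mean value step on [sin z - z], whose derivative is at most [z^2 / 2] in absolute value;
    hence 1/2 instead of the optimal 1/6. *)
Lemma sin_taylor3 x : `|sin x - x| <= `|x| ^+ 3 / 2.
Proof.
wlog x0 : x / 0 <= x.
  move=> H; have [/H//|/ltW x0] := leP 0 x.
  have := H (- x); rewrite oppr_ge0 => /(_ x0).
  by rewrite sinN -opprD !normrN.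
have df z : is_derive z (1 : R) (fun z => sin z - z) (cos z - 1).
  by apply: is_deriveB.
have cf : {within `[0, x], continuous (fun z : R => sin z - z)}.
  by apply: derivable_within_continuous => z _; have [] := df z.
have [z zx] := MVT_segment x0 (fun z _ => df z) cf.
rewrite sin0 !subr0 => ->; rewrite normrM (ger0_norm x0).
move: zx; rewrite in_itv/= => /andP[z0 zx].
rewrite exprSr mulrAC ler_wpM2r//; apply: le_trans (cos_sub1_le _) _.
by rewrite ler_wpM2r// lerXn2r.
Qed.

(** The identity [1 - cos x = 2 sin^2 (x/2)] turns the remainder into a difference of two squares,
    so the cubic bound for the sine suffices. *)
Lemma cos_taylor4 x : `|cos x - 1 + x ^+ 2 / 2| <= x ^+ 4 / 8.
Proof.
set y := x / 2; have -> : x = 2 * y by rewrite /y mulrC divfK.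
have -> : cos (2 * y) - 1 + (2 * y) ^+ 2 / 2 = - (2 * ((sin y - y) * (sin y + y))).
  by have := cos_half (2 * y); rewrite (mulrC 2) mulfK// => H; lra.
rewrite normrN !normrM (ger0_norm (ler0n _ 2)).
have H1 := sin_taylor3 y.
have H2 : `|sin y + y| <= 2 * `|y|.
  by have := ler_norm_sin y; have := ler_normD (sin y) y; lra.
have := ler_pM (normr_ge0 _) (normr_ge0 _) H1 H2.
have -> : (2 * y) ^+ 4 = 16 * `|y| ^+ 4.
  by rewrite exprMn -normrX ger0_norm ?exprn_even_ge0//; ring.
by rewrite !exprS expr0; lra.
Qed.

Lemma expRN_taylor x : 0 <= x -> `|expR (- x) - 1 + x| <= x ^+ 2.
Proof.
move=> x0; have H1 := expR_ge1Dx (- x).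
have H2 := expR_ge1Dx x.
have : expR (- x) * expR x = 1 by rewrite -expRD addNr expR0.
have := expR_gt0 (- x); move: H1 H2; set e := expR (- x); set f := expR x.
move=> H1 H2 e0 ef.
have H3 : e * (1 + x) <= 1 by have := ler_wpM2l (ltW e0) H2; rewrite ef.
rewrite ger0_norm; last by lra.
have := mulr_ge0 (mulr_ge0 x0 x0) (ltW e0).
nra.
Qed.

Lemma ler_dist_expRN x y : 0 <= x -> 0 <= y ->
  `|expR (- x) - expR (- y)| <= `|x - y|.
Proof.
wlog xy : x y / x <= y.
  move=> H x0 y0; have [xy|/ltW yx] := leP x y; first exact: H.
  by rewrite distrC (distrC x); exact: H.
move=> x0 y0; rewrite ger0_norm; last by rewrite subr_ge0 ler_expR lerN2.
rewrite distrC ger0_norm ?subr_ge0//.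
have -> : expR (- y) = expR (- x) * expR (- (y - x)).
  by rewrite -expRD; congr expR; ring.
have H1 := expR_ge1Dx (- (y - x)).
have H2 : expR (- x) <= 1 by rewrite -expR0 ler_expR oppr_le0.
have := expR_gt0 (- x); move: H1 H2; set e := expR (- x); set f := expR _.
nra.
Qed.

End trig_estimates.

Section double_limit.
Context {R : realType}.

Lemma inv_sqrt_cvg0 : ((Num.sqrt (n%:R : R))^-1 @[n --> \oo] --> (0 : R)).
Proof.
apply/cvgrPdist_lt => e e0.
exists (Num.truncn (e ^-2)).+1 => // n /= ne.
rewrite sub0r normrN ger0_norm ?invr_ge0//.
have n0 : (0 < n)%N by apply: leq_ltn_trans ne.
rewrite invf_plt ?posrE ?sqrtr_gt0 ?ltr0n//.
rewrite -(@ltr_pXn2r _ 2)// ?nnegrE ?sqrtr_ge0 ?invr_ge0 ?ltW//.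
rewrite sqr_sqrtr// exprVn; apply: lt_le_trans (truncnS_gt _) _.
by rewrite ler_nat.
Qed.

Lemma inv_nat_cvg0 : ((n%:R : R)^-1 @[n --> \oo] --> (0 : R)).
Proof.
rewrite -[X in _ --> X](mulr0 0).
rewrite (_ : (fun n => _) = (fun n => (Num.sqrt (n%:R : R))^-1 * (Num.sqrt n%:R)^-1)).
  by apply: cvgM; exact: inv_sqrt_cvg0.
by apply/funext => n; rewrite -invfM -expr2 sqr_sqrtr.
Qed.

(** For fixed [q], the second error vanishes as [n] grows, however large [K q] is; so [u] eventually
    stays close to [s q], hence is Cauchy, and its limit inherits the first error. *)
Lemma double_limit (u s : nat -> R) (a : R) (K : nat -> R) :
  (forall q n, (0 < q)%N -> (0 < n)%N ->
    `|u n - s q| <= a / Num.sqrt q%:R + K q / Num.sqrt n%:R) ->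
  exists2 l, u @ \oo --> l &
    forall q, (0 < q)%N -> `|l - s q| <= a / Num.sqrt q%:R.
Proof.
move=> H.
have near_u q e : (0 < q)%N -> 0 < e ->
    \forall n \near \oo, `|u n - s q| <= a / Num.sqrt q%:R + e.
  move=> q0 e0.
  have : K q / Num.sqrt n%:R @[n --> \oo] --> K q * 0.
    by apply: cvgM; [exact: cvg_cst|exact: inv_sqrt_cvg0].
  rewrite mulr0 => /cvgrPdist_le /(_ _ e0) Ke.
  near=> n; apply: le_trans (H q n q0 _) _; first by near: n; exists 1%N.
  rewrite lerD2l; apply: le_trans (ler_norm _) _.
  by rewrite -normrN -sub0r; near: n.
have cu : cvg (u @ \oo).
  apply/cauchy_cvgP/cauchy_exP => e e0.
  have e2 : 0 < e / 3 by rewrite divr_gt0.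
  have : a / Num.sqrt n%:R @[n --> \oo] --> a * 0.
    by apply: cvgM; [exact: cvg_cst|exact: inv_sqrt_cvg0].
  rewrite mulr0 => /cvgrPdist_lt /(_ _ e2)[q _ Hq].
  have {Hq} := Hq q.+1 (leqnSn _); rewrite /= sub0r normrN => Hq.
  exists (s q.+1); apply: filterS (near_u q.+1 _ _ e2) => // n.
  have := ler_norm (a / Num.sqrt q.+1%:R).
  by rewrite /= -ball_normE /= distrC; move: Hq; lra.
exists (lim (u @ \oo)) => // q q0.
apply/ler_addgt0Pr => e e0.
have c2 : `|u n - s q| @[n --> \oo] --> `|lim (u @ \oo) - s q|.
  by apply: cvg_norm; apply: cvgB => //; exact: cvg_cst.
rewrite -(cvg_lim _ c2)//; apply: limr_le; last exact: near_u.
by apply/cvg_ex; eexists; exact: c2.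
Unshelve. all: by end_near.
Qed.
End double_limit.

(** * Central limit theorem for blocks *)

Section word_clt.
Context {R : realType} {A : finType}.
Hypothesis A0 : (0 < #|A|)%N.
Implicit Types (F G : seq A -> R).

Lemma word_mean_dist_le n F G B : (forall s, size s = n -> `|F s - G s| <= B) ->
  `|word_mean n F - word_mean n G| <= B.
Proof.
move=> FG; rewrite -word_meanB; apply: le_trans (ler_norm_word_mean _ _) _.
by rewrite -[B](word_mean_cst A0 n); exact: word_mean_le.
Qed.

Lemma word_mean_dist_cst n F a B : (forall s, size s = n -> `|F s - a| <= B) ->
  `|word_mean n F - a| <= B.
Proof. by move=> Fa; rewrite -[a](word_mean_cst A0 n); exact: word_mean_dist_le. Qed.

(** The two parts of a uniform word are independent, so the centred cross term averages to 0. *)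
Lemma word_var_cat m n (F G H : seq A -> R) :
  (forall u v, size u = m -> size v = n -> H (u ++ v) = F u + G v) ->
  word_mean (m + n) H = word_mean m F + word_mean n G /\
  word_var (m + n) H = word_var m F + word_var n G.
Proof.
move=> HFG.
have E : word_mean (m + n) H = word_mean m F + word_mean n G.
  rewrite word_mean_cat -[X in _ + X](word_mean_cst A0 m) -word_meanD; apply: word_mean_eq => u um.
  rewrite -[X in X + _](word_mean_cst A0 n) -word_meanD; apply: word_mean_eq => v vn.
  exact: HFG.
split => //; rewrite /word_var E word_mean_cat.
set a := word_mean m F; set b := word_mean n G.
transitivity (word_mean m (fun u => (F u - a) ^+ 2 + word_var n G)).
  apply: word_mean_eq => u um.
  transitivity (word_mean n (fun v => ((F u - a) ^+ 2 + (G v - b) ^+ 2) +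
       2 * (F u - a) * (G v - b))).
    by apply: word_mean_eq => v vn; rewrite HFG//; ring.
  by rewrite !word_meanD word_meanZ word_meanD word_meanN !(word_mean_cst A0) subrr mulr0 addr0.
by rewrite word_meanD (word_mean_cst A0).
Qed.

(** After the addition formula, the mean of the sine is of third order because [zeta] is centred,
    and the mean of the cosine is [1 - a^2 v / 2] up to fourth order. The last error comes from
    replacing this by the exponential. *)
Lemma word_mean_one_block n (zeta : seq A -> R) (B a x v : R) :
  word_mean n (fun s => zeta s ^+ 2) = v -> word_mean n zeta = 0 ->
  (forall s, size s = n -> `|zeta s| <= B) ->
  `|word_mean n (fun s => cos (x + a * zeta s)) - expR (- (a ^+ 2 * v / 2)) * cos x| <=
  (`|a| * B) ^+ 4 / 8 + (`|a| * B) ^+ 3 / 2 + (a ^+ 2 * v / 2) ^+ 2.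
Proof.
move=> vE z0 zB.
have v0 : 0 <= v by rewrite -vE; apply: word_mean_ge0 => // s _; exact: sqr_ge0.
have azB s : size s = n -> `|a * zeta s| <= `|a| * B.
  by move=> sn; rewrite normrM ler_wpM2l// zB.
set b := `|a| * B in azB *.
pose C := word_mean n (fun s => cos (a * zeta s)); pose S := word_mean n (fun s => sin (a * zeta s)).
have -> : word_mean n (fun s => cos (x + a * zeta s)) = cos x * C - sin x * S.
  by rewrite -!word_meanZ -word_meanB; apply: word_mean_eq => s _; rewrite cosD.
have HS : `|S| <= b ^+ 3 / 2.
  have -> : S = S - word_mean n (fun s => a * zeta s) by rewrite word_meanZ z0 mulr0 subr0.
  apply: word_mean_dist_le => s sn; apply: le_trans (sin_taylor3 _) _.
  by rewrite ler_wpM2r// lerXn2r ?nnegrE// ?azB// (le_trans _ (azB s sn)).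
have HC : `|C - (1 - a ^+ 2 * v / 2)| <= b ^+ 4 / 8.
  have -> : 1 - a ^+ 2 * v / 2 = word_mean n (fun s => 1 - (a * zeta s) ^+ 2 / 2).
    rewrite word_meanB (word_mean_cst A0) word_meanZr; congr (_ - _ * _).
    by rewrite -vE -word_meanZ; apply: word_mean_eq => s _; rewrite exprMn.
  apply: word_mean_dist_le => s sn; rewrite opprB addrCA addrC.
  apply: le_trans (cos_taylor4 _) _.
  rewrite ler_wpM2r// (_ : (a * zeta s) ^+ 4 = `|a * zeta s| ^+ 4).
    by rewrite lerXn2r ?nnegrE// ?azB// (le_trans _ (azB s sn)).
  by rewrite -normrX ger0_norm// exprn_even_ge0.
have HE := expRN_taylor (divr_ge0 (mulr_ge0 (sqr_ge0 a) v0) (ler0n R 2)).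
set w := a ^+ 2 * v / 2 in HC HE *.
have -> : cos x * C - sin x * S - expR (- w) * cos x =
  cos x * (C - (1 - w)) - sin x * S - cos x * (expR (- w) - 1 + w) by ring.
apply: le_trans (ler_normB _ _) _; apply: lerD.
  apply: le_trans (ler_normB _ _) _; rewrite !normrM; apply: lerD.
    by rewrite -[leRHS]mul1r ler_pM// cos_max.
  by rewrite -[leRHS]mul1r ler_pM// sin_max.
by rewrite normrM -[leRHS]mul1r ler_pM// cos_max.
Qed.

End word_clt.

Section blocks.
Context {R : realType} {A : finType}.
Hypothesis A0 : (0 < #|A|)%N.
Variables (q : nat) (q0 : (0 < q)%N) (y : seq A -> R) (b : R).
(* [y (x :: s)] only depends on [x] and on the letters of [s] in the current block *)
Hypothesis y_local : forall x u v,
  (q %| size v)%N -> y (x :: u ++ v) = y (x :: u).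
Hypothesis y_bnd : forall s, `|y s| <= b.

Let Y := suffix_sum y.

Let b0 : 0 <= b. Proof. exact: le_trans (y_bnd [::]). Qed.

Lemma suffix_sum_cat u v : (q %| size v)%N -> Y (u ++ v) = Y u + Y v.
Proof.
move=> qv; elim: u => [|x u IH]; first by rewrite add0r.
by rewrite /Y /= y_local// -/Y IH addrA.
Qed.

Lemma suffix_sum_le s : `|Y s| <= (size s)%:R * b.
Proof.
elim: s => [|x s IH]; first by rewrite normr0 mul0r.
rewrite /Y/= -/Y (le_trans (ler_normD _ _))//.
have := y_bnd (x :: s); rewrite -natr1; move: IH; lra.
Qed.

Let m := word_mean q Y.
Let v := word_var q Y.
(** Bounds a centred sum over at most [q] letters: the sum and its mean are each at most [q b] in
    absolute value. *)
Let B := 2 * q%:R * b.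

Let B0 : 0 <= B. Proof. by rewrite !mulr_ge0. Qed.

Let dist_mean n : (n <= q)%N -> forall s, size s = n -> `|Y s - word_mean n Y| <= B.
Proof.
move=> nq s sn.
have Yb w : size w = n -> `|Y w| <= q%:R * b.
  by move=> wn; rewrite (le_trans (suffix_sum_le w))// ler_wpM2r// wn ler_nat.
apply: le_trans (ler_normB _ _) _; rewrite /B -mulrA mulr_natl mulr2n lerD ?Yb//.
by rewrite -[word_mean n Y]subr0; apply: word_mean_dist_cst => // w wn; rewrite subr0 Yb.
Qed.

(** Blocks are counted from the oldest letter, so the incomplete block consists of the [j] newest
    letters and sits at the head of the word. *)
Lemma blocks_moments r j : (j < q)%N ->
  word_mean (j + r * q) Y = word_mean j Y + r%:R * m /\
  word_var (j + r * q) Y = word_var j Y + r%:R * v.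
Proof.
move=> jq.
have HY k k' u w : size u = k -> size w = (k' * q)%N -> Y (u ++ w) = Y u + Y w.
  by move=> _ wn; rewrite suffix_sum_cat// wn dvdn_mull.
have [-> ->] := word_var_cat A0 (HY j r).
suff [-> ->] : word_mean (r * q) Y = r%:R * m /\ word_var (r * q) Y = r%:R * v by [].
elim: r => [|r [IH1 IH2]].
  by rewrite !mul0r mul0n /word_var /word_mean /Y /= subrr expr0n.
by rewrite mulSn; have [-> ->] := word_var_cat A0 (HY q r);
  rewrite IH1 IH2 -/m -/v -natr1; split; ring.
Qed.

Let delta a := (`|a| * B) ^+ 4 / 8 + (`|a| * B) ^+ 3 / 2 + (a ^+ 2 * v / 2) ^+ 2.

(** Blocks are integrated out from the oldest to the newest: the induction hypothesis is applied
    with the phase shifted by the newest block, which is then averaged by the one-block estimate.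
    All factors have modulus at most 1, so the errors just add up. *)
Lemma blocks_cos r a x :
  `|word_mean (r * q) (fun s => cos (x + a * (Y s - r%:R * m))) -
    expR (- (a ^+ 2 * v / 2)) ^+ r * cos x| <= r%:R * delta a.
Proof.
have w0 : 0 <= a ^+ 2 * v / 2.
  by rewrite divr_ge0// mulr_ge0 ?sqr_ge0//; exact: word_var_ge0.
set e := expR _; have e01 : 0 <= e <= 1.
  by rewrite expR_ge0 -expR0 ler_expR oppr_le0.
have /andP[e0 e1] := e01.
elim: r x => [|r IH] x.
  by rewrite mul0n /word_mean /Y /= !mul0r subrr mulr0 addr0 expr0 mul1r subrr normr0.
rewrite mulSn word_mean_cat.
have zB : forall s, size s = q -> `|Y s - m| <= B by exact: dist_mean.
have z0 : word_mean q (fun s => Y s - m) = 0 by rewrite word_meanB (word_mean_cst A0) subrr.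
have := word_mean_one_block A0 a x (erefl v) z0 zB; rewrite -/e -/(delta a).
set F := word_mean q _ => H1.
have H2 : `|word_mean q (fun u => word_mean (r * q) (fun w =>
      cos (x + a * (Y (u ++ w) - r.+1%:R * m)))) - e ^+ r * F| <= r%:R * delta a.
  rewrite /F -word_meanZ; apply: word_mean_dist_le => // u uq.
  have := IH (x + a * (Y u - m)).
  congr (`|_ - _| <= _); apply: word_mean_eq => w wn; congr cos.
  by rewrite suffix_sum_cat ?wn ?dvdn_mull// -natr1; ring.
have H3 : `|e ^+ r * F - e ^+ r.+1 * cos x| <= delta a.
  rewrite exprSr -mulrA -mulrBr normrM -[leRHS]mul1r ler_pM//.
  by rewrite normrX ger0_norm// exprn_ile1.
have := ler_normD (word_mean q (fun u => word_mean (r * q) (fun w =>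
      cos (x + a * (Y (u ++ w) - r.+1%:R * m)))) - e ^+ r * F)
  (e ^+ r * F - e ^+ r.+1 * cos x).
rewrite addrA subrK => /le_trans; apply.
by rewrite [leRHS](_ : _ = r%:R * delta a + delta a) ?lerD// -natr1 mulrDl mul1r.
Qed.

(** The discrepancy is the variance of the incomplete block minus its proportional share of [v], and
    is bounded independently of [n]. *)
Lemma blocks_var n : (0 < n)%N ->
  `|word_var n Y / n%:R - v / q%:R| <= (B ^+ 2 + v) / n%:R.
Proof.
move=> n0; have jq := ltn_pmod n q0.
have v0 : 0 <= v by exact: word_var_ge0.
have [_ H] := blocks_moments (n %/ q) jq.
rewrite addnC -divn_eq in H; rewrite H.
have j0 := word_var_ge0 A0 (n %% q) Y.
have jB : word_var (n %% q) Y <= B ^+ 2.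
  rewrite -[leRHS](word_mean_cst A0 (n %% q)); apply: word_mean_le => s sn.
  rewrite -(real_normK (num_real (_ - _))) lerXn2r ?nnegrE//.
  by rewrite dist_mean// ltnW.
have n0' : 0 < n%:R :> R by rewrite ltr0n.
have q0' : 0 < q%:R :> R by rewrite ltr0n.
have -> : (word_var (n %% q) Y + (n %/ q)%:R * v) / n%:R - v / q%:R =
  (word_var (n %% q) Y - (n %% q)%:R / q%:R * v) / n%:R.
  have nR : n%:R = (n %/ q)%:R * q%:R + (n %% q)%:R :> R.
    by rewrite -natrM -natrD -divn_eq.
  by rewrite nR; field; rewrite -nR !gt_eqF.
rewrite normrM [ `|n%:R^-1|]ger0_norm ?invr_ge0// ler_wpM2r ?invr_ge0//.
apply: le_trans (ler_normB _ _) _; rewrite ger0_norm// lerD// ger0_norm.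
  rewrite -[leRHS]mul1r ler_wpM2r// ler_pdivrMr// mul1r ler_nat ltnW//.
by rewrite mulr_ge0// divr_ge0.
Qed.

Lemma blocks_clt t : exists K, forall n x, (0 < n)%N ->
  `|word_mean n (fun s => cos (x + t / Num.sqrt n%:R * (Y s - word_mean n Y))) -
    expR (- (t ^+ 2 * (v / q%:R) / 2)) * cos x| <= K / Num.sqrt n%:R.
Proof.
have v0 : 0 <= v by exact: word_var_ge0.
(* The first three summands bound the accumulated one-block errors ([H4]), [|t| * B] the incomplete
   block ([H2]), and the last the replacement of [r / n] by [1 / q] ([H3]). *)
exists ((`|t| * B) ^+ 4 / 8 + (`|t| * B) ^+ 3 / 2 + (t ^+ 2 * v / 2) ^+ 2 +
   `|t| * B + t ^+ 2 * v / 2) => n x n0.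
have jq := ltn_pmod n q0.
set j := (n %% q)%N in jq; set r := (n %/ q)%N.
have nE : n = (j + r * q)%N by rewrite addnC -divn_eq.
set sn := Num.sqrt _.
have n1 : 1 <= n%:R :> R by rewrite ler1n.
have sn1 : 1 <= sn by rewrite -sqrtr1 ler_wsqrtr.
have sn0 : 0 < sn by exact: lt_le_trans sn1.
have sn2 : sn ^+ 2 = n%:R by rewrite sqr_sqrtr.
set a := t / sn; set w := a ^+ 2 * v / 2.
have w0 : 0 <= w by rewrite divr_ge0// mulr_ge0// sqr_ge0.
have [HE _] := blocks_moments r jq; rewrite -nE in HE; rewrite HE.
have H1 : `|word_mean n (fun s => cos (x + a * (Y s - (word_mean j Y + r%:R * m)))) -
   expR (- w) ^+ r * word_mean j (fun u => cos (x + a * (Y u - word_mean j Y)))| <= r%:R * delta a.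
  rewrite nE word_mean_cat -word_meanZ; apply: word_mean_dist_le => // u uj.
  have := blocks_cos r a (x + a * (Y u - word_mean j Y)).
  congr (`|_ - _| <= _); apply: word_mean_eq => z zn; congr cos.
  by rewrite suffix_sum_cat ?zn ?dvdn_mull//; ring.
have H2 : `|expR (- w) ^+ r * word_mean j (fun u => cos (x + a * (Y u - word_mean j Y))) -
    expR (- w) ^+ r * cos x| <= `|t| * B / sn.
  rewrite -mulrBr normrM -[leRHS]mul1r ler_pM//.
    rewrite normrX ger0_norm ?expR_ge0// exprn_ile1 ?expR_ge0//.
    by rewrite -expR0 ler_expR oppr_le0.
  apply: word_mean_dist_cst => // u uj; apply: le_trans (ler_dist_cos _ _) _.
  rewrite addrAC subrr add0r normrM /a normrM [ `|sn^-1|]ger0_norm ?invr_ge0 ?(ltW sn0)//.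
  rewrite mulrAC ler_wpM2r ?invr_ge0 ?(ltW sn0)// ler_wpM2l//.
  by rewrite dist_mean// ltnW.
have H3 : `|expR (- w) ^+ r * cos x - expR (- (t ^+ 2 * (v / q%:R) / 2)) * cos x|
    <= t ^+ 2 * v / 2 / sn.
  rewrite -mulrBl normrM -[leRHS]mulr1 ler_pM// ?cos_max//.
  rewrite -expRM_natl mulrN.
  apply: le_trans (ler_dist_expRN _ _) _.
  - by rewrite mulr_ge0.
  - by rewrite !(sqr_ge0, divr_ge0, mulr_ge0).
  have n0' : 0 < n%:R :> R by rewrite ltr0n.
  have q0' : 0 < q%:R :> R by rewrite ltr0n.
  have -> : r%:R * w - t ^+ 2 * (v / q%:R) / 2 =
    - (t ^+ 2 * v / 2 * (j%:R / q%:R / n%:R)).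
    have nR : n%:R = j%:R + r%:R * q%:R :> R by rewrite -natrM -natrD -nE.
    by rewrite /w /a expr_div_n sn2 nR; field; rewrite -nR !gt_eqF.
  rewrite normrN ger0_norm; last by rewrite !(sqr_ge0, divr_ge0, mulr_ge0).
  rewrite ler_wpM2l//; first by rewrite !(sqr_ge0, divr_ge0, mulr_ge0).
  rewrite -sn2 expr2 invfM mulrA ler_piMl ?invr_ge0 ?(ltW sn0)//.
  rewrite mulr_ile1 ?invr_ge0 ?divr_ge0 ?invf_le1 ?(ltW sn0)//.
  by rewrite ler_pdivrMr// mul1r ler_nat ltnW.
have H4 : r%:R * delta a <=
   ((`|t| * B) ^+ 4 / 8 + (`|t| * B) ^+ 3 / 2 + (t ^+ 2 * v / 2) ^+ 2) / sn.
  have rn : r%:R <= sn ^+ 2 by rewrite sn2 ler_nat leq_div.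
  have d0 : 0 <= delta a.
    by rewrite /delta addr_ge0 ?sqr_ge0// addr_ge0// divr_ge0// exprn_ge0// mulr_ge0.
  apply: le_trans (ler_wpM2r d0 rn) _.
  have -> : sn ^+ 2 * delta a = ((`|t| * B) ^+ 4 / 8 / sn + (`|t| * B) ^+ 3 / 2 +
     (t ^+ 2 * v / 2) ^+ 2 / sn) / sn.
    rewrite /delta /a normrM [ `|sn^-1|]ger0_norm ?invr_ge0 ?(ltW sn0)//.
    by field; rewrite gt_eqF.
  have i1 : sn^-1 <= 1 by rewrite invf_le1.
  rewrite ler_wpM2r ?invr_ge0 ?(ltW sn0)//; rewrite lerD ?lerD//.
    by rewrite ler_piMr// !(exprn_ge0, divr_ge0, mulr_ge0).
  by rewrite ler_piMr// sqr_ge0.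
rewrite -/a.
set X1 := word_mean n _ in H1 *; set X2 := _ * word_mean j _ in H1 H2.
set X3 := expR (- w) ^+ r * cos x in H2 H3; set X4 := _ * cos x in H3 *.
have -> : X1 - X4 = (X1 - X2) + (X2 - X3) + (X3 - X4) by ring.
apply: le_trans (ler_normD _ _) _; rewrite mulrDl lerD//.
apply: le_trans (ler_normD _ _) _; rewrite mulrDl lerD//.
exact: le_trans H4.
Qed.

End blocks.

(** * From block sums to the gain with full look-back in the word *)

Section words_clt.
Context {R : realType} {A : finType}.
Hypothesis A1 : (1 < #|A|)%N.
Variables (h : nat -> R) (c : R).
Hypothesis h_incr : forall n, 0 <= h n.+1 - h n <= c.

Let A0 : (0 < #|A|)%N. Proof. exact: ltnW. Qed.
Let gam : R := Num.sqrt (1 - #|A|%:R^-1).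

Let gam_ge0 : 0 <= gam. Proof. exact: sqrtr_ge0. Qed.

Let gam_lt1 : gam < 1.
Proof.
rewrite -[ltRHS]sqrtr1 ltr_sqrt// ltrBlDr ltrDl invr_gt0 ltr0n//.
Qed.

Let c_ge0 : 0 <= c.
Proof. by have /andP[] := h_incr 0; exact: le_trans. Qed.

Definition recurrence_gain (s : seq A) : R :=
  if s is x :: s' then h (index x s') else 0.

(** [size s' %% q] counts the letters between the beginning of the current block and the newest
    letter; the first letter of a block sees nothing and receives [h 0]. *)
Definition block_gain q (s : seq A) : R :=
  if s is x :: s' then h (index x (take (size s' %% q) s')) else 0.

Let Z := suffix_sum recurrence_gain.
Let Y q := suffix_sum (block_gain q).
Let D q := suffix_sum (excess h (fun n => n %% q)%N : seq A -> R).

Lemma block_gain_local q x u v :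
  (q %| size v)%N -> block_gain q (x :: u ++ v) = block_gain q (x :: u).
Proof.
move=> /dvdnP[k vk]; rewrite /block_gain size_cat vk addnC modnMDl; congr (h (index _ _)).
by rewrite takel_cat// leq_mod.
Qed.

Lemma block_gain_le q s : (0 < q)%N -> `|block_gain q s| <= `|h 0| + c * q%:R.
Proof.
move=> q0; case: s => [|x s]; first by rewrite normr0 addr_ge0// mulr_ge0.
rewrite /block_gain; set i := index _ _.
have iq : (i <= q)%N.
  rewrite /i (leq_trans (index_size _ _))// size_take.
  by case: ifP => [_|/negbT]; rewrite -?leqNgt; have := ltn_pmod (size s) q0; lia.
have /andP[H1 H2] := increments_le h_incr (leq0n i).
rewrite subn0 in H2; rewrite -[h i](subrK (h 0)) addrC.
rewrite (le_trans (ler_normD _ _))// lerD2l ger0_norm// (le_trans H2)//.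
by rewrite ler_wpM2l// ler_nat.
Qed.

Lemma gain_split q s : Z s = Y q s + D q s.
Proof.
rewrite -suffix_sumD; elim: s => [//|x s IH]; rewrite /Z /= -/Z IH.
by congr (_ + _); ring.
Qed.

(** The constant of the variance bound for the lost gain, times the geometric sum [1 / (1 - gam)]
    that each block contributes. *)
Let K0 : R := 2 * c ^+ 2 * #|A|%:R ^+ 2 * (1 + 2 * #|A|%:R) / (1 - gam).

Let K0_ge0 : 0 <= K0.
Proof.
rewrite divr_ge0 ?subr_ge0 ?(ltW gam_lt1)//.
by rewrite mulr_ge0 ?addr_ge0 ?mulr_ge0 ?sqr_ge0.
Qed.

Lemma word_var_excess_le q n : (0 < q)%N -> (0 < n)%N ->
  word_var n (D q) <= K0 * n%:R * (q%:R^-1 + n%:R^-1).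
Proof.
move=> q0 n0; apply: le_trans (word_var_excess_sum A1 h_incr _ n) _.
rewrite -/gam.
have n0' : 0 < n%:R :> R by rewrite ltr0n.
have q0' : 0 < q%:R :> R by rewrite ltr0n.
have -> : K0 * n%:R * (q%:R^-1 + n%:R^-1) =
   2 * c ^+ 2 * #|A|%:R ^+ 2 * (1 + 2 * #|A|%:R) * ((n%:R / q%:R + 1) / (1 - gam)).
  by rewrite /K0; field; rewrite !gt_eqF ?subr_gt0.
rewrite ler_wpM2l ?mulr_ge0 ?addr_ge0 ?mulr_ge0 ?sqr_ge0//.
rewrite ler_pdivlMr ?subr_gt0// mulrC (le_trans (sum_expr_modn_le _ gam_ge0 q0))//.
by rewrite lerD2r ler_pdivlMr// -natrM ler_nat leq_divM.
Qed.

Let cen n F (s : seq A) : R := F s - word_mean n F.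

Let cen_split q n s : cen n Z s = cen n (Y q) s + cen n (D q) s.
Proof.
rewrite /cen (gain_split q) (_ : word_mean n Z = word_mean n (Y q) + word_mean n (D q)).
  by ring.
by rewrite -word_meanD; apply: word_mean_eq => w _; exact: gain_split.
Qed.

(** Blocks of length 1 see no past, so their sum is deterministic and all fluctuation of the gain is
    in the lost part; the bound for that part at [q = 1] applies. *)
Lemma word_var_gain_le n : (0 < n)%N -> word_var n Z <= 2 * K0 * n%:R.
Proof.
move=> n0; have := @word_var_excess_le 1 n isT n0.
have -> : word_var n Z = word_var n (D 1).
  apply: word_mean_eq => s sn; congr (_ ^+ 2).
  have Y1 w : Y 1 w = (size w)%:R * h 0.
    elim: w => [|x w IH]; first by rewrite mul0r.
    by rewrite /Y /= -/(Y 1) IH modn1 take0 -[in RHS]natr1 /=; ring.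
  have := cen_split 1 n s; rewrite /cen => ->; rewrite Y1 sn.
  rewrite (@word_mean_eq _ _ n (Y 1) (fun=> n%:R * h 0)) ?(word_mean_cst A0) ?subrr ?add0r//.
  by move=> w wn; rewrite Y1 wn.
move=> /le_trans; apply.
have -> : 2 * K0 * n%:R = K0 * n%:R * (1 + 1) by ring.
rewrite invr1 ler_wpM2l ?(mulr_ge0 K0_ge0)//.
by rewrite lerD2l invf_le1 ?ltr0n// ler1n.
Qed.

Lemma word_mean_norm_le n (F : seq A -> R) B : 0 <= B ->
  word_mean n (fun s => F s ^+ 2) <= B ^+ 2 ->
  word_mean n (fun s => `|F s|) <= B.
Proof.
move=> B0 H; rewrite -(@ler_pXn2r _ 2)// ?nnegrE//; last exact: word_mean_ge0.
apply: le_trans H; have := word_var_ge0 A0 n (fun s => `|F s|).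
rewrite (word_varE A0) subr_ge0 => /le_trans; apply; apply: word_mean_le => s _.
by rewrite real_normK ?num_real.
Qed.

Let inv_sqrt_le1 n : (0 < n)%N -> 0 < (Num.sqrt (n%:R : R))^-1 <= 1.
Proof.
move=> n0; rewrite invr_gt0 sqrtr_gt0 ltr0n n0/= invf_le1 ?sqrtr_gt0 ?ltr0n//.
by rewrite -[leLHS]sqrtr1 ler_wsqrtr// ler1n.
Qed.

Let inv_sqrtE n : (n%:R : R)^-1 = (Num.sqrt n%:R)^-1 ^+ 2.
Proof. by rewrite exprVn sqr_sqrtr. Qed.

Lemma word_var_gain_blocks q n : (0 < q)%N -> (0 < n)%N ->
  `|word_var n Z / n%:R - word_var n (Y q) / n%:R| <=
  4 * K0 / Num.sqrt q%:R + K0 * (Num.sqrt q%:R + 1) / Num.sqrt n%:R.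
Proof.
move=> q0 n0.
have /andP[iq0 iq1] := inv_sqrt_le1 q0; have /andP[in0 in1] := inv_sqrt_le1 n0.
have Hz := word_var_gain_le n0; have Hd := word_var_excess_le q0 n0.
rewrite !inv_sqrtE in Hd.
set p := Num.sqrt q%:R in iq0 iq1 Hd *; set r := Num.sqrt n%:R in in0 in1 Hd *.
have p0 : 0 < p by rewrite -invr_gt0.
have n0' : 0 < n%:R :> R by rewrite ltr0n.
set d := word_var n (D q) in Hd; set z := word_var n Z in Hz *.
have d0 : 0 <= d by exact: word_var_ge0.
have z0 : 0 <= z by exact: word_var_ge0.
(* The cross term is split by [2 |a e| <= a^2 / p + p e^2] with [p = sqrt q]: the variance of the
   gain is of order [n] and that of the loss of order [n / q + 1], so the leading parts of both
   terms are of order [n / sqrt q]. *)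
have H : `|z - word_var n (Y q)| <= p^-1 * z + p * d + d.
  rewrite -word_meanB; apply: le_trans (ler_norm_word_mean _ _) _.
  rewrite /z /d /word_var -!word_meanZ -!word_meanD; apply: word_mean_le => s sn.
  have := cen_split q n s; rewrite /cen.
  set a := Z s - _; set b := Y q s - _; set e := D q s - _ => ab.
  have -> : a ^+ 2 - b ^+ 2 = 2 * (a * e) - e ^+ 2 by rewrite ab; ring.
  rewrite (le_trans (ler_normB _ _))// [ `|e ^+ 2|]ger0_norm ?sqr_ge0// lerD2r.
  rewrite ler_norml; apply/andP; split.
    rewrite lerNl -subr_ge0.
    have -> : p^-1 * a ^+ 2 + p * e ^+ 2 - - (2 * (a * e)) = p^-1 * (a + p * e) ^+ 2.
      by field; rewrite gt_eqF.
    by rewrite mulr_ge0 ?sqr_ge0// ltW.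
  rewrite -subr_ge0.
  have -> : p^-1 * a ^+ 2 + p * e ^+ 2 - 2 * (a * e) = p^-1 * (a - p * e) ^+ 2.
    by field; rewrite gt_eqF.
  by rewrite mulr_ge0 ?sqr_ge0// ltW.
rewrite -mulrBl normrM [ `|n%:R^-1|]ger0_norm ?invr_ge0// ler_pdivrMr//.
apply: le_trans H _.
have H1 : p^-1 * z <= p^-1 * (2 * K0 * n%:R) by rewrite ler_wpM2l// ltW.
have H2 : (p + 1) * d <= (p + 1) * (K0 * n%:R * (p^-1 ^+ 2 + r^-1 ^+ 2)).
  by rewrite ler_wpM2l// addr_ge0// ltW.
have H3 : K0 * n%:R * ((p^-1 + p^-1 ^+ 2) + (p + 1) * r^-1 ^+ 2) <=
    K0 * n%:R * (2 * p^-1 + (p + 1) * r^-1).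
  rewrite ler_wpM2l ?(mulr_ge0 K0_ge0)//; apply: lerD.
    by rewrite mulr_natl mulr2n lerD2l expr2 ler_piMl// ltW.
  by rewrite ler_wpM2l ?addr_ge0 ?(ltW p0)// expr2 ler_piMl// ltW.
have e : (p + 1) * (K0 * n%:R * (p^-1 ^+ 2 + r^-1 ^+ 2)) =
   K0 * n%:R * ((p^-1 + p^-1 ^+ 2) + (p + 1) * r^-1 ^+ 2).
  by field; rewrite -invr_eq0 !gt_eqF.
rewrite e in H2; move: H1 H2 H3; lra.
Qed.

(** The cosine is 1-Lipschitz, and the L^1 norm of the centred loss is at most its L^2 norm. *)
Lemma dist_gain_blocks q n t x : (0 < q)%N -> (0 < n)%N ->
  `|word_mean n (fun s => cos (x + t / Num.sqrt n%:R * cen n Z s)) -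
    word_mean n (fun s => cos (x + t / Num.sqrt n%:R * cen n (Y q) s))| <=
  `|t| * Num.sqrt K0 / Num.sqrt q%:R + `|t| * Num.sqrt K0 / Num.sqrt n%:R.
Proof.
move=> q0 n0.
have /andP[iq0 iq1] := inv_sqrt_le1 q0; have /andP[in0 in1] := inv_sqrt_le1 n0.
have := word_var_excess_le q0 n0; rewrite !inv_sqrtE.
have rn : Num.sqrt n%:R ^+ 2 = n%:R :> R by rewrite sqr_sqrtr.
set p := Num.sqrt q%:R in iq0 iq1 *; set r := Num.sqrt n%:R in in0 in1 rn *.
have r0 : 0 < r by rewrite -invr_gt0.
have k2 : Num.sqrt K0 ^+ 2 = K0 by rewrite sqr_sqrtr.
have k0 : 0 <= Num.sqrt K0 by exact: sqrtr_ge0.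
move: (Num.sqrt K0) k2 k0 => k <- k0 H.
have HD : word_mean n (fun s => `|cen n (D q) s|) <= k * r * (p^-1 + r^-1).
  apply: word_mean_norm_le; first by rewrite !mulr_ge0 ?addr_ge0 ?(ltW r0) ?(ltW iq0) ?(ltW in0).
  apply: le_trans H _; rewrite -rn !exprMn ler_wpM2l ?(mulr_ge0 (sqr_ge0 _) (sqr_ge0 _))//.
  by rewrite sqrrD addrAC lerDl mulrn_wge0// mulr_ge0// ltW.
rewrite -word_meanB; apply: le_trans (ler_norm_word_mean _ _) _.
apply: (@le_trans _ _ (word_mean n (fun s => `|t| / r * `|cen n (D q) s|))).
  apply: word_mean_le => s sn; apply: le_trans (ler_dist_cos _ _) _.
  rewrite (cen_split q) (_ : _ - _ = t / r * cen n (D q) s); last by ring.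
  by rewrite !normrM [ `|r^-1|]ger0_norm ?(ltW in0)// ler_wpM2l.
rewrite word_meanZ.
have -> : `|t| * k / p + `|t| * k / r = `|t| / r * (k * r * (p^-1 + r^-1)).
  by field; rewrite -[p == 0]invr_eq0 !gt_eqF.
by rewrite ler_wpM2l// mulr_ge0// ltW.
Qed.

Lemma words_clt : exists tau : R,
  [/\ 0 <= tau, word_var n Z / n%:R @[n --> \oo] --> tau &
   forall t x, word_mean n (fun s => cos (x + t / Num.sqrt n%:R * (Z s - word_mean n Z)))
      @[n --> \oo] --> expR (- (t ^+ 2 * tau / 2)) * cos x].
Proof.
pose sigma q : R := word_var q (Y q) / q%:R.
have sigma0 q : 0 <= sigma q by rewrite divr_ge0// word_var_ge0.
pose b q : R := `|h 0| + c * q%:R.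
have yl q : forall x u v, (q %| size v)%N ->
   block_gain q (x :: u ++ v) = block_gain q (x :: u) := @block_gain_local q.
have yb q (q0 : (0 < q)%N) s : `|block_gain q s| <= b q by exact: block_gain_le.
have Vs q n : (0 < q)%N -> (0 < n)%N ->
   `|word_var n Z / n%:R - sigma q| <= 4 * K0 / Num.sqrt q%:R +
   (K0 * (Num.sqrt q%:R + 1) + ((2 * q%:R * b q) ^+ 2 + word_var q (Y q))) / Num.sqrt n%:R.
  move=> q0 n0.
  have H1 := word_var_gain_blocks q0 n0.
  have H2 := blocks_var A0 q0 (@yl q) (yb q q0) n0.
  have /andP[in0 in1] := inv_sqrt_le1 n0.
  have H3 : ((2 * q%:R * b q) ^+ 2 + word_var q (Y q)) / n%:R <=
     ((2 * q%:R * b q) ^+ 2 + word_var q (Y q)) / Num.sqrt n%:R.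
    rewrite ler_wpM2l//; first by rewrite addr_ge0 ?sqr_ge0 ?word_var_ge0.
    by rewrite inv_sqrtE expr2 ler_piMl// ltW.
  have := ler_normD (word_var n Z / n%:R - word_var n (Y q) / n%:R)
    (word_var n (Y q) / n%:R - sigma q).
  rewrite addrA subrK => /le_trans; apply.
  by move: H1 (le_trans H2 H3); rewrite -/(sigma q); lra.
(* Besides the existence of [tau], this gives the rate at which the block variances [sigma q]
   approach it, used below to identify the limit of the cosine means. *)
have [tau Vtau stau] := double_limit Vs.
have tau0 : 0 <= tau.
  rewrite -(cvg_lim _ Vtau)//; apply: limr_ge.
    by apply/cvg_ex; exists tau.
  by apply: nearW => n; rewrite divr_ge0// word_var_ge0.
exists tau; split => // t x.
have [K HK] : exists K : nat -> R, forall q n, (0 < q)%N -> (0 < n)%N ->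
  `|word_mean n (fun s => cos (x + t / Num.sqrt n%:R * cen n (Y q) s)) -
    expR (- (t ^+ 2 * sigma q / 2)) * cos x| <= K q / Num.sqrt n%:R.
  have H q : exists K : R, forall n, (0 < q)%N -> (0 < n)%N ->
    `|word_mean n (fun s => cos (x + t / Num.sqrt n%:R * cen n (Y q) s)) -
      expR (- (t ^+ 2 * sigma q / 2)) * cos x| <= K / Num.sqrt n%:R.
    case: (posnP q) => [->|q0]; first by exists 0.
    have [K HK] := blocks_clt A0 q0 (@yl q) (yb q q0) t.
    by exists K => n _ n0; exact: HK.
  have [K HK] := choice H; exists K => q n q0 n0; exact: HK.
have Es q n : (0 < q)%N -> (0 < n)%N ->
   `|word_mean n (fun s => cos (x + t / Num.sqrt n%:R * cen n Z s)) -
      expR (- (t ^+ 2 * sigma q / 2)) * cos x| <=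
    `|t| * Num.sqrt K0 / Num.sqrt q%:R +
    (`|t| * Num.sqrt K0 + K q) / Num.sqrt n%:R.
  move=> q0 n0; have H1 := dist_gain_blocks t x q0 n0; have H2 := HK q n q0 n0.
  have := ler_normD (word_mean n (fun s => cos (x + t / Num.sqrt n%:R * cen n Z s)) -
      word_mean n (fun s => cos (x + t / Num.sqrt n%:R * cen n (Y q) s)))
    (word_mean n (fun s => cos (x + t / Num.sqrt n%:R * cen n (Y q) s)) -
     expR (- (t ^+ 2 * sigma q / 2)) * cos x).
  by rewrite addrA subrK => /le_trans; apply; move: H1 H2; lra.
have [l El ls] := double_limit Es.
suff -> : expR (- (t ^+ 2 * tau / 2)) * cos x = l by [].
have pos u : 0 <= u -> 0 <= t ^+ 2 * u / 2.
  by move=> u0; rewrite divr_ge0// mulr_ge0// sqr_ge0.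
pose a := `|t| * Num.sqrt K0 + t ^+ 2 / 2 * (4 * K0).
(* The limit [l] and the Gaussian value at [tau] are both within a multiple of [1 / sqrt q] of the
   Gaussian value at [sigma q], for every [q], so they agree. *)
have H q : (0 < q)%N -> `|expR (- (t ^+ 2 * tau / 2)) * cos x - l| <= a / Num.sqrt q%:R.
  move=> q0; have H1 := ls q q0; have H2 := stau q q0.
  have H3 : `|expR (- (t ^+ 2 * tau / 2)) * cos x - expR (- (t ^+ 2 * sigma q / 2)) * cos x|
     <= t ^+ 2 / 2 * (4 * K0 / Num.sqrt q%:R).
    rewrite -mulrBl normrM -[leRHS]mulr1 ler_pM ?cos_max//.
    apply: le_trans (ler_dist_expRN (pos _ tau0) (pos _ (sigma0 q))) _.
    rewrite (_ : _ - _ = t ^+ 2 / 2 * (tau - sigma q)); last by ring.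
    by rewrite normrM ger0_norm ?divr_ge0 ?sqr_ge0// ler_wpM2l// divr_ge0// sqr_ge0.
  rewrite distrC in H1.
  have := ler_normD (expR (- (t ^+ 2 * tau / 2)) * cos x - expR (- (t ^+ 2 * sigma q / 2)) * cos x)
    (expR (- (t ^+ 2 * sigma q / 2)) * cos x - l).
  by rewrite addrA subrK => /le_trans; apply; move: H1 H3; rewrite /a; lra.
apply/eqP; rewrite -subr_eq0 -normr_le0.
apply/ler_addgt0Pr => e e0; rewrite add0r.
have : a / Num.sqrt n%:R @[n --> \oo] --> a * 0.
  by apply: cvgM; [exact: cvg_cst|exact: inv_sqrt_cvg0].
rewrite mulr0 => /cvgrPdist_lt /(_ _ e0)[q _ Hq].
have {Hq} := Hq q.+1 (leqnSn _); rewrite /= sub0r normrN => Hq.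
by apply: le_trans (H q.+1 isT) _; apply: le_trans (ler_norm _) (ltW Hq).
Qed.

End words_clt.

(** * Convergence of cosine means implies convergence in distribution *)

Section weierstrass.
Context {R : realType}.
Implicit Types (G H : nat -> R) (y : R).

(* [(bernstein n G).[y]] is the mean of [G] under the binomial law with
   parameters [n] and [y] *)
Fixpoint bernstein n G : {poly R} :=
  if n is m.+1 then (1 - 'X) * bernstein m G + 'X * bernstein m (fun k => G k.+1)
  else (G 0%N)%:P.

Lemma horner_bernsteinS n G y : (bernstein n.+1 G).[y] =
  (1 - y) * (bernstein n G).[y] + y * (bernstein n (fun k => G k.+1)).[y].
Proof. by rewrite /= !hornerE. Qed.

Lemma bernstein_le n G H y : 0 <= y <= 1 ->
  (forall k, (k <= n)%N -> G k <= H k) -> (bernstein n G).[y] <= (bernstein n H).[y].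
Proof.
move=> /andP[y0 y1]; elim: n G H => [|n IH] G H GH.
  by rewrite !hornerC; exact: GH.
rewrite !horner_bernsteinS lerD// ler_wpM2l ?subr_ge0//; apply: IH => k kn; apply: GH => //.
exact: leqW.
Qed.

Lemma bernstein_affine n G a b y :
  (bernstein n (fun k => a * G k + b)).[y] = a * (bernstein n G).[y] + b.
Proof.
elim: n G => [|n IH] G; first by rewrite !hornerC.
by rewrite !horner_bernsteinS !IH; ring.
Qed.

(** Binomial variance plus squared bias. The centre [a] is arbitrary because the recursion shifts
    the count by one, which is absorbed into [a]. *)
Lemma bernstein_sqr n a y : (bernstein n (fun k => (k%:R - a) ^+ 2)).[y] =
  n%:R * (y * (1 - y)) + (n%:R * y - a) ^+ 2.
Proof.
elim: n a => [|n IH] a; first by rewrite hornerC; ring.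
rewrite horner_bernsteinS IH.
rewrite (_ : (fun k => (k.+1%:R - a) ^+ 2) = (fun k => (k%:R - (a - 1)) ^+ 2)).
  by rewrite IH -natr1; ring.
by apply/funext => k; rewrite -natr1; congr (_ ^+ 2); ring.
Qed.

Lemma unif_cont01 (F : R -> R) e : continuous F -> 0 < e ->
  exists2 d, 0 < d & forall x y, 0 <= x <= 1 -> `|x - y| < d -> `|F x - F y| < e.
Proof.
move=> cF e0.
have cpt : near_covering `[0 : R, 1].
  by apply/compact_near_coveringP; exact: segment_compact.
pose P (d x : R) := forall y, `|x - y| < d -> `|F x - F y| < e.
have [x _|d0 /= d00 Hd] := cpt _ (0 : R)^'+ P.
  have /cvgrPdist_lt /(_ (e / 2)) := cF x.
  rewrite divr_gt0// => /(_ isT) /nbhs_ballP [r /= r0 Hr].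
  have r2 : 0 < r / 2 by rewrite divr_gt0.
  exists (ball x (r / 2), `]0, r / 2[%classic) => /=.
    split; first exact: nbhsx_ballx.
    exists (r / 2) => //= z; rewrite /ball_ /= sub0r normrN => zr z0.
    by rewrite in_itv/= z0 (le_lt_trans (ler_norm _) zr).
  move=> [z d] /= [xz]; rewrite in_itv/= => /andP[d0 dr] w zw.
  rewrite -ball_normE /= in xz.
  have H1 : `|F x - F z| < e / 2.
    by apply: Hr; rewrite -ball_normE /=; move: xz; lra.
  have H2 : `|F x - F w| < e / 2.
    apply: Hr; rewrite -ball_normE /=.
    have := ler_normD (x - z) (z - w); rewrite addrA subrK; move: xz zw; lra.
  have := ler_normD (F z - F x) (F x - F w); rewrite addrA subrK.
  by rewrite (distrC (F z) (F x)); move: H1 H2; lra.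
exists (d0 / 2); first by rewrite divr_gt0.
move=> x y x01 xy.
have := Hd (d0 / 2); rewrite /ball_/= sub0r normrN ger0_norm ?divr_ge0 ?(ltW d00)//.
rewrite ltr_pdivrMr// ltr_pMr// ltr1n => /(_ isT); rewrite divr_gt0// => /(_ isT x).
by rewrite /= in_itv/= => /(_ x01); exact.
Qed.

(** Chebyshev's argument: where [k / n] is near [y] uniform continuity applies, elsewhere the
    oscillation [2 M] is at most a multiple of [(k / n - y)^2]. Averaging this quadratic bound gives
    the binomial variance. *)
Lemma weierstrass (F : R -> R) e : continuous F -> 0 < e ->
  exists p : {poly R}, forall y, 0 <= y <= 1 -> `|p.[y] - F y| <= e.
Proof.
move=> cF e0.
have e2 : 0 < e / 2 by rewrite divr_gt0.
have [d d0 Hd] := unif_cont01 cF e2.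
have [M M0 HM] : exists2 M, 0 <= M & forall x, 0 <= x <= 1 -> `|F x| <= M.
  have cF01 : {within `[0, 1], continuous F} by exact: continuous_subspaceT.
  have [a _ Ha] := EVT_max ler01 cF01.
  have [b _ Hb] := EVT_min ler01 cF01.
  exists (`|F a| + `|F b|) => [|x x01]; first by rewrite addr_ge0.
  have x01' : x \in `[0, 1] by rewrite in_itv.
  have := Ha x x01'; have := Hb x x01'; have := ler_norm (F a).
  have := ler_norm (- F b); rewrite normrN ler_norml.
  have := normr_ge0 (F a); have := normr_ge0 (F b).
  by move=> *; apply/andP; split; lra.
pose n := (Num.truncn (2 * M / (d ^+ 2 * (e / 2)))).+1.
exists (bernstein n (fun k => F (k%:R / n%:R))) => y y01.
have n0 : 0 < n%:R :> R by rewrite ltr0n.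
have /andP[y0 y1] := y01.
pose B : R := 2 * M / d ^+ 2.
have B0 : 0 <= B by rewrite /B divr_ge0 ?sqr_ge0// mulr_ge0.
have key k : (k <= n)%N -> `|F (k%:R / n%:R) - F y| <=
    B / n%:R ^+ 2 * (k%:R - n%:R * y) ^+ 2 + e / 2.
  move=> kn.
  have k01 : 0 <= (k%:R / n%:R : R) <= 1.
    by rewrite divr_ge0//= ler_pdivrMr// mul1r ler_nat.
  have [/(Hd _ _ k01) H|H] := ltP `|k%:R / n%:R - y| d.
    apply: le_trans (ltW H) _; rewrite lerDr; apply: mulr_ge0; last exact: sqr_ge0.
    by apply: divr_ge0 => //; exact: sqr_ge0.
  have H1 : `|F (k%:R / n%:R) - F y| <= 2 * M.
    have := ler_normB (F (k%:R / n%:R)) (F y); have := HM _ k01; have := HM y y01.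
    lra.
  have H2 : 2 * M <= B / n%:R ^+ 2 * (k%:R - n%:R * y) ^+ 2.
    rewrite (_ : B / _ * _ = B * (k%:R / n%:R - y) ^+ 2); last first.
      by field; rewrite gt_eqF.
    rewrite /B mulrAC ler_pdivlMr ?exprn_gt0// ler_wpM2l ?mulr_ge0//.
    rewrite -[leRHS](real_normK (num_real _)).
    by rewrite lerXn2r ?nnegrE ?(ltW d0).
  move: H1 H2; lra.
have key2 : `|(bernstein n (fun k => F (k%:R / n%:R))).[y] - F y| <=
    (bernstein n (fun k => B / n%:R ^+ 2 * (k%:R - n%:R * y) ^+ 2 + e / 2)).[y].
  rewrite ler_norml lerBrDl lerBlDl.
  have H1 : (bernstein n (fun k => F (k%:R / n%:R))).[y] <= (bernstein n (fun k =>
     1 * (B / n%:R ^+ 2 * (k%:R - n%:R * y) ^+ 2 + e / 2) + F y)).[y].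
    apply: bernstein_le => // k kn; have := key k kn; rewrite ler_norml; lra.
  have H2 : (bernstein n (fun k =>
     -1 * (B / n%:R ^+ 2 * (k%:R - n%:R * y) ^+ 2 + e / 2) + F y)).[y] <=
     (bernstein n (fun k => F (k%:R / n%:R))).[y].
    apply: bernstein_le => // k kn; have := key k kn; rewrite ler_norml; lra.
  by rewrite !bernstein_affine in H1 H2 *; apply/andP; split; lra.
apply: le_trans key2 _.
rewrite (bernstein_affine n (fun k => (k%:R - n%:R * y) ^+ 2)).
rewrite bernstein_sqr subrr expr0n/= addr0.
have H : B / n%:R <= e / 2.
  rewrite ler_pdivrMr// mulrC -ler_pdivrMr//.
  rewrite (_ : B / (e / 2) = 2 * M / (d ^+ 2 * (e / 2))); last first.
    by rewrite /B; field; rewrite !gt_eqF.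
  exact/ltW/truncnS_gt.
have -> : B / n%:R ^+ 2 * (n%:R * (y * (1 - y))) = B / n%:R * (y * (1 - y)).
  by field; rewrite gt_eqF.
have : B / n%:R * (y * (1 - y)) <= B / n%:R.
  apply: ler_piMr; first by apply: divr_ge0 => //; exact: ltW.
  by nra.
by move: H; lra.
Qed.
End weierstrass.

Section sin_range.
Context {R : realType}.

Lemma sin1_lt1 : sin 1 < 1 :> R.
Proof.
have := cos2Dsin2 (1 : R); have := cos1_gt0 R; nra.
Qed.

(* on [-A, A], [f] is a continuous function of [sin (x / A)] *)
Lemma sin_factor (f : R -> R) (A M : R) : 0 < A -> continuous f ->
  (forall x, `|f x| <= M) ->
  exists F : R -> R, [/\ continuous F, forall y, `|F y| <= M &
    forall x, `|x| <= A -> f x = F ((1 + sin (x / A)) / 2)].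
Proof.
move=> A0 cf fM; pose s : R := sin 1.
have s1 : s < 1 := sin1_lt1.
have s0 : 0 < s by rewrite sin2_gt0// ltr01 ltr1n.
(* Clamping at [sin 1 < 1] keeps [asin] strictly inside its domain, so that [F] is defined and
   continuous on the whole line; for [|x| <= A] the clamp does nothing. *)
pose clamp (u : R) := Num.max (- s) (Num.min s u).
have clampP u : - s <= clamp u <= s.
  by rewrite /clamp le_max lexx/= ge_max ge_min lexx/= andbT; lra.
have clamp_id u : - s <= u <= s -> clamp u = u.
  by move=> /andP[su us]; rewrite /clamp (min_r us) max_r.
exists (fun y => f (A * asin (clamp (2 * y - 1)))); split => //.
- move=> y.
  have cu : continuous (fun y : R => 2 * y - 1).
    by move=> z; apply: cvgB; [apply: cvgM; [exact: cvg_cst|exact: cvg_id]|exact: cvg_cst].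
  have cc : continuous clamp.
    have -> : clamp = (fun=> - s) \max ((fun=> s) \min id) by [].
    move=> z; apply: (@continuous_max R R^o); first exact: cvg_cst.
    by apply: (@continuous_min R R^o); [exact: cvg_cst|exact: cvg_id].
  apply: continuous_comp; last exact: cf.
  apply: cvgM; first exact: cvg_cst.
  apply: continuous_cvg.
    by apply: continuous_asin; have := clampP (2 * y - 1); lra.
  exact: continuous_comp (cu y) (cc _).
- move=> x xA.
  have z1 : -1 <= x / A <= 1.
    by rewrite -ler_norml normrM [ `|A^-1|]ger0_norm ?invr_ge0 ?(ltW A0)// ler_pdivrMr// mul1r.
  have p1 := pihalf_ge1 R.
  have in1 (u : R) : -1 <= u <= 1 -> u \in `[- (pi / 2), pi / 2].
    by rewrite in_itv/=; lra.
  have sz : - s <= sin (x / A) <= s.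
    have /andP[z11 z12] := z1.
    have sin_mono : {in `[- (pi / 2), pi / 2] &, {mono (@sin R) : u v / u <= v}}.
      by apply: le_mono_in => u v uI vI uv; rewrite ltr_sin.
    have i1 : (1 : R) \in `[- (pi / 2), pi / 2] by apply: in1; apply/andP; split; lra.
    have iN1 : (-1 : R) \in `[- (pi / 2), pi / 2] by apply: in1; apply/andP; split; lra.
    have iz := in1 _ z1.
    by rewrite /s -sinN (sin_mono _ _ iN1 iz) (sin_mono _ _ iz i1) z11 z12.
  have -> : 2 * ((1 + sin (x / A)) / 2) - 1 = sin (x / A) by field.
  rewrite clamp_id// sinK; last exact: in1.
  by rewrite mulrC divfK// gt_eqF.
Qed.
End sin_range.

Section bounded_integral.
Context {R : realType} d {T : measurableType d} (P : probability T R).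

Lemma bounded_integrable (f : T -> R) (M : R) : measurable_fun setT f ->
  (forall x, `|f x| <= M) -> P.-integrable setT (EFin \o f).
Proof.
move=> mf fM; apply: measurable_bounded_integrable => //.
  by rewrite (le_lt_trans (probability_le1 _ _))// ltry.
by exists M; split => [|N MN x _ /=]; [exact: num_real|rewrite (le_trans (fM x))// ltW].
Qed.

Lemma dist_Rintegral_le (f g : T -> R) (M e : R) (A : set T) :
  measurable_fun setT f -> measurable_fun setT g -> measurable A ->
  (forall x, `|f x| <= M) -> (forall x, `|g x| <= M) ->
  0 <= e -> (forall x, ~ A x -> `|f x - g x| <= e) ->
  `|\int[P]_x f x - \int[P]_x g x| <= e + 2 * M * fine (P A).
Proof.
move=> mf mg mA fM gM e0 fg.
have If := bounded_integrable mf fM; have Ig := bounded_integrable mg gM.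
rewrite -RintegralB//.
have Ifg : P.-integrable setT (EFin \o (fun x => f x - g x)).
  apply: (@bounded_integrable _ (M + M)); first exact: measurable_funB.
  by move=> x; rewrite (le_trans (ler_normB _ _))// lerD.
apply: le_trans (le_normr_Rintegral measurableT Ifg) _.
have M0 : 0 <= 2 * M by rewrite mulr_ge0// (le_trans _ (fM point)).
have Ie : P.-integrable setT (EFin \o (fun=> e : R)).
  by apply: (@bounded_integrable _ e) => // x; rewrite ger0_norm.
have I1 : P.-integrable setT (EFin \o (\1_A : T -> R)).
  apply: (@bounded_integrable _ 1); first exact: measurable_indic.
  by move=> x; rewrite indicE; case: (_ \in _); rewrite ?normr1 ?normr0.
have I2 : P.-integrable setT (EFin \o (fun x => 2 * M * \1_A x)).
  apply: (@bounded_integrable _ (2 * M)).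
    by apply: measurable_funM => //; exact: measurable_indic.
  move=> x; rewrite indicE; case: (_ \in _); rewrite ?mulr1 ?mulr0 ?normr0//.
  by rewrite ger0_norm.
apply: (@le_trans _ _ (\int[P]_x (e + 2 * M * \1_A x))).
  apply: le_Rintegral => //.
  - by rewrite (_ : _ \o _ = (abse \o (EFin \o (fun x => f x - g x)%R))%E)//;
      exact: integrable_abse.
  - rewrite (_ : _ \o _ = ((EFin \o (fun=> e : R)) \+ (EFin \o (fun x => 2 * M * \1_A x)%R))%E)//.
    exact: integrableD.
  - move=> x _; rewrite indicE; have [Ax|Ax] := boolP (x \in A).
      rewrite mulr1 (le_trans (ler_normB _ _))//.
      by have := fM x; have := gM x; lra.
    by rewrite mulr0 addr0 fg// => /mem_set; exact/negP.
rewrite RintegralD// RintegralZl// Rintegral_cst//= probability_setT /= mulr1.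
by rewrite /Rintegral integral_indic// setIT.
Qed.

End bounded_integral.

Section cos_determines_convergence.
Context {R : realType}.
Local Notation prob := (probability (measurableTypeR R) R).

(** Continuity from above along the sets [n < |x|], which decrease to the empty set. *)
Lemma probability_tight (nu : prob) (e : R) : 0 < e ->
  exists A : R, [/\ 0 < A & (nu [set x | (A < `|x|)%R] <= e%:E)%E].
Proof.
move=> e0.
pose F (n : nat) := [set x : measurableTypeR R | n%:R < `|x|].
have mF n : measurable (F n).
  rewrite (_ : F n = (fun x : R => `|x|) @^-1` `]n%:R, +oo[).
    rewrite -[X in measurable X]setTI; apply: measurableT_comp => //.
  by apply/seteqP; split => x /=; rewrite in_itv/= andbT.
have H : nu (F n) @[n --> \oo] --> nu (\bigcap_n F n).
  apply: nonincreasing_cvg_mu => //.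
  - by rewrite (le_lt_trans (probability_le1 _ _))// ltry.
  - exact: bigcap_measurable.
  - apply/nonincreasing_seqP => n; apply/subsetPset => x /=.
    by apply: le_lt_trans; rewrite ler_nat.
have e1 : \bigcap_n F n = set0.
  apply/seteqP; split => // x /= /(_ (Num.truncn `|x|).+1 I).
  by rewrite /F /= => /(lt_trans (truncnS_gt `|x|)); rewrite ltxx.
rewrite e1 measure0 in H.
have /fine_cvgP[Hf /cvgrPdist_lt /(_ _ e0) [n0 _ Hn]] := H.
have := Hn n0.+1 (leqnSn _); rewrite /= sub0r normrN => Hn0.
exists n0.+1%:R; split; first by rewrite ltr0n.
rewrite -[leLHS]fineK; last by apply: fin_num_measure; exact: mF.
by rewrite lee_fin (le_trans (ler_norm _) (ltW Hn0)).
Qed.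

Context {d : measure_display} {T : measurableType d} (P : probability T R).
Variables (X : nat -> {RV P >-> R}) (nu : prob).
Hypothesis cos_cvg : forall t s : R,
  \int[P]_w cos (t * X n w + s) @[n --> \oo] --> \int[nu]_x cos (t * x + s).

(** The bounded measurable test functions whose means converge. They form a vector space containing
    the cosines. *)
Let good (h : R -> R) := [/\ measurable_fun setT h, exists M, forall x, `|h x| <= M &
  \int[P]_w h (X n w) @[n --> \oo] --> \int[nu]_x h x].

Let good_int h : good h -> nu.-integrable setT (EFin \o h).
Proof. by move=> [mh [M hM] _]; exact: (bounded_integrable nu mh hM). Qed.

Let good_int_comp h n : good h -> P.-integrable setT (EFin \o (fun w => h (X n w))).
Proof.
move=> [mh [M hM] _]; apply: (@bounded_integrable _ _ _ P _ M) => //.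
exact: measurableT_comp.
Qed.

Let goodD h1 h2 : good h1 -> good h2 -> good (fun x => h1 x + h2 x).
Proof.
move=> g1 g2; have [m1 [M1 hM1] c1] := g1; have [m2 [M2 hM2] c2] := g2; split.
- exact: measurable_funD.
- by exists (M1 + M2) => x; rewrite (le_trans (ler_normD _ _))// lerD.
- rewrite RintegralD//; [|exact: good_int|exact: good_int].
  under eq_fun => n do rewrite RintegralD ?good_int_comp//.
  exact: cvgD.
Qed.

Let goodZ a h : good h -> good (fun x => a * h x).
Proof.
move=> g1; have [m1 [M1 hM1] c1] := g1; split.
- exact: measurable_funM.
- by exists (`|a| * M1) => x; rewrite normrM ler_wpM2l.
- rewrite RintegralZl//; last exact: good_int.
  under eq_fun => n do rewrite RintegralZl ?good_int_comp//.
  by apply: cvgM => //; exact: cvg_cst.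
Qed.

Let good_cos t s : good (fun x => cos (t * x + s)).
Proof.
split => //; last by exists 1 => x; exact: cos_max.
apply: (measurableT_comp (f := @cos R)).
  by apply: continuous_measurable_fun; exact: continuous_cos.
by apply: measurable_funD => //; exact: measurable_funM.
Qed.

(* products of sines and cosines linearize *)
Let good_poly (A : R) (p : {poly R}) t s :
  good (fun x => p.[(1 + sin (x / A)) / 2] * cos (t * x + s)).
Proof.
elim/poly_ind: p t s => [|p c IH] t s.
  rewrite (_ : (fun _ => _) = (fun x => 0 * cos (t * x + s))); first exact: goodZ.
  by apply/funext => x; rewrite horner0.
pose u x := p.[(1 + sin (x / A)) / 2].
(* The factor [(1 + sin (x / A)) / 2] contributes one half from the 1, and two quarters from
   [sin a cos b], with sines written as cosines shifted by [pi / 2]; this is why [t] and [s] vary in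
   the induction. *)
rewrite (_ : (fun _ => _) = (fun x =>
  (2^-1 * (u x * cos (t * x + s)) +
  (4^-1 * (u x * cos ((t + A^-1) * x + (s - pi / 2))) +
   4^-1 * (u x * cos ((A^-1 - t) * x + (- s - pi / 2))))) + c * cos (t * x + s))).
  by apply: goodD; [apply: goodD; [|apply: goodD]|]; apply: goodZ; try exact: IH.
apply/funext => x; rewrite hornerMXaddC -/(u x).
have -> : (t + A^-1) * x + (s - pi / 2) = (x / A + (t * x + s)) - pi / 2 by ring.
have -> : (A^-1 - t) * x + (- s - pi / 2) = (x / A - (t * x + s)) - pi / 2 by ring.
by rewrite !cosBpihalf sinD sinB; field.
Qed.

Hypothesis tight : forall e : R, 0 < e -> exists A : R,
  0 < A /\ \forall n \near \oo, (P [set w | (A < `|X n w|)%R] <= e%:E)%E.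

Lemma cvg_in_distribution_cos (f : R -> R) : continuous f -> bounded_fun f ->
  (\int[distribution P (X n)]_x (f x)%:E)%E @[n --> \oo] --> (\int[nu]_x (f x)%:E)%E.
Proof.
move=> cf [M0 [_ HM0]].
pose M := Num.max 0 (M0 + 1).
have M_ge0 : 0 <= M by rewrite le_max lexx.
have fM x : `|f x| <= M.
  by apply: le_trans (HM0 (M0 + 1) _ x I) _; rewrite ?ltrDl// le_max lexx orbT.
have mf : measurable_fun setT f by exact: continuous_measurable_fun.
have mfX n : measurable_fun setT (fun w => f (X n w)) by exact: measurableT_comp.
have IfX n : P.-integrable setT (EFin \o (fun w => f (X n w))).
  by apply: (bounded_integrable P (mfX n)) => w; exact: fM.
suff H : \int[P]_w f (X n w) @[n --> \oo] --> \int[nu]_x f x.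
  have -> : (\int[nu]_x (f x)%:E)%E = (\int[nu]_x f x)%:E.
    rewrite /Rintegral fineK//; apply: integrable_fin_num => //.
    exact: (bounded_integrable nu mf fM).
  rewrite (_ : (fun n => _) = (fun n => (\int[P]_w f (X n w))%:E)).
    by apply: cvg_EFin => //; exact: nearW.
  apply/funext => n; rewrite integral_distribution//.
    rewrite /Rintegral fineK//; exact: (integrable_fin_num measurableT (IfX n)).
  - exact/measurable_EFinP.
  - exact: IfX.
apply/cvgrPdist_le => e e0.
pose M1 := M + 1.
(* Makes [e1 + 2 * M1 * e1] equal to [e / 3]: closeness inside [[-A, A]] plus the mass outside. *)
pose e1 := e / (3 * (1 + 2 * M1)).
have den0 : 0 < 3 * (1 + 2 * M1) by rewrite /M1; lra.
have e10 : 0 < e1 by rewrite divr_gt0.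
have [A1 [A10 HA1]] := tight e10.
have [A2 [A20 HA2]] := probability_tight nu e10.
pose A := Num.max A1 A2.
have A0 : 0 < A by rewrite lt_max A10.
have mA (B : R) : measurable [set x : R | B < `|x|].
  rewrite (_ : [set _ | _] = (fun x : R => `|x|) @^-1` `]B, +oo[).
    rewrite -[X in measurable X]setTI; apply: measurableT_comp => //.
  by apply/seteqP; split => x /=; rewrite in_itv/= andbT.
have mAX n (B : R) : measurable [set w | B < `|X n w|].
  by apply: (measurable_funPTI (X n) (mA B)).
have [F [cF FM fF]] := sin_factor A0 cf fM.
(* The accuracy is also capped at 1, so that the trigonometric polynomial is bounded by [M1 = M + 1]
   on the whole line; [e1] was itself defined from [M1]. *)
have e1min : 0 < Num.min e1 1 by rewrite lt_min e10 ltr01.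
have [p Hp] := weierstrass cF e1min.
pose w x : R := (1 + sin (x / A)) / 2.
have w01 x : 0 <= w x <= 1.
  have := sin_le1 (x / A); have := sin_geN1 (x / A); rewrite /w => *; apply/andP; split; lra.
pose h x := p.[w x].
have gh : good h.
  rewrite (_ : h = (fun x => p.[(1 + sin (x / A)) / 2] * cos (0 * x + 0))).
    exact: good_poly.
  by apply/funext => x; rewrite mul0r addr0 cos0 mulr1.
have [mh _ ch] := gh.
have hM x : `|h x| <= M1.
  have := Hp _ (w01 x); rewrite le_min => /andP[_ H].
  rewrite -[h x](subrK (F (w x))) (le_trans (ler_normD _ _))// addrC.
  by rewrite lerD// (le_trans (FM _)).
have fM' x : `|f x| <= M1 by rewrite (le_trans (fM x))// lerDl.
have fh x : ~ (A < `|x|) -> `|f x - h x| <= e1.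
  move=> /negP; rewrite -leNgt => xA.
  by rewrite (fF x xA) distrC; have := Hp _ (w01 x); rewrite le_min => /andP[].
have e3E : e / 3 = e1 + 2 * M1 * e1.
  by rewrite /e1; field; rewrite gt_eqF//; move: den0; lra.
have M10 : 0 <= 2 * M1 by rewrite mulr_ge0// /M1 addr_ge0.
have Hnu : `|\int[nu]_x f x - \int[nu]_x h x| <= e / 3.
  apply: le_trans (dist_Rintegral_le nu mf mh (mA A) fM' hM (ltW e10) fh) _.
  rewrite e3E lerD2l ler_wpM2l// -lee_fin fineK; last by apply: fin_num_measure; exact: mA.
  apply: le_trans HA2; apply: le_measure; rewrite ?inE//; [exact: mA|exact: mA|].
  by move=> x /=; apply: le_lt_trans; rewrite le_max lexx orbT.
have e3 : 0 < e / 3 by rewrite divr_gt0.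
move/cvgrPdist_le : ch => /(_ _ e3) ch.
near=> n.
have H1 : `|\int[nu]_x h x - \int[P]_w h (X n w)| <= e / 3 by near: n.
have H2 : `|\int[P]_w f (X n w) - \int[P]_w h (X n w)| <= e / 3.
  have mhX : measurable_fun setT (fun w => h (X n w)) by exact: measurableT_comp.
  have := @dist_Rintegral_le _ _ _ P _ _ M1 e1 _ (mfX n) mhX (mAX n A)
    (fun w => fM' _) (fun w => hM _) (ltW e10) (fun w => fh (X n w)).
  move=> /le_trans; apply.
  rewrite e3E lerD2l ler_wpM2l// -lee_fin fineK; last exact: fin_num_measure.
  apply: (@le_trans _ _ (P [set w | A1 < `|X n w|])); last by near: n.
  apply: le_measure; rewrite ?inE//.
  by move=> x /=; apply: le_lt_trans; rewrite le_max lexx.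
have := ler_normD (\int[nu]_x f x - \int[nu]_x h x) (\int[nu]_x h x - \int[P]_w h (X n w)).
have := ler_normD (\int[nu]_x f x - \int[P]_w h (X n w))
  (\int[P]_w h (X n w) - \int[P]_w f (X n w)).
rewrite (distrC (\int[P]_w h (X n w))) !addrA !subrK.
by move: H1 H2 Hnu; lra.
Unshelve. all: by end_near.
Qed.

End cos_determines_convergence.

(** * Cosine means of the normal law *)

Section derive_lemmas.
Context {R : realType}.
Implicit Types f g : R -> R.
Notation mu := (@lebesgue_measure R).

Lemma is_derive_mulr f g x (df dg : R) :
  is_derive x (1 : R) f df -> is_derive x (1 : R) g dg ->
  is_derive x (1 : R) (fun z => f z * g z) (f x * dg + g x * df).
Proof. by move=> Hf Hg; exact: is_deriveM. Qed.

Lemma is_derive_affine (t s x : R) :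
  is_derive x (1 : R) (fun z => t * z + s) t.
Proof.
have H : is_derive x (1 : R) (fun z : R => t * z) t.
  by apply: is_derive_eq (is_derive_mulr (is_derive_cst t x 1) (is_derive_id x 1)) _;
    rewrite mulr1 mulr0 addr0.
by apply: is_derive_eq (is_deriveD H (is_derive_cst s x 1)) _; rewrite addr0.
Qed.

Lemma is_derive_scale_sqr (k x : R) :
  is_derive x (1 : R) (fun z => k * z ^+ 2) (2 * k * x).
Proof.
have H : is_derive x (1 : R) (fun z : R => z ^+ 2) (2 * x).
  have := is_derive_mulr (is_derive_id x 1) (is_derive_id x 1).
  by move=> H; apply: is_derive_eq H _; rewrite mulr1 mulr_natl mulr2n.
by apply: is_derive_eq (is_derive_mulr (is_derive_cst k x 1) H) _;
  rewrite /cst mulr0 addr0; ring.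
Qed.

(** The fundamental theorem of calculus on [[-n, n]], followed by dominated convergence. *)
Lemma integral_derive_eq0 (G g : R -> R) :
  (forall x, is_derive x (1 : R) G (g x)) -> continuous g ->
  mu.-integrable setT (EFin \o g) ->
  G n%:R - G (- n%:R) @[n --> \oo] --> 0 ->
  \int[mu]_x g x = 0.
Proof.
move=> dG cg ig G0.
have mg : measurable_fun setT g by exact: continuous_measurable_fun.
pose f_ n := g \_ `[(- n%:R : R), n%:R].
have f_E n : (0 < n)%N -> \int[mu]_x (f_ n x) = G n%:R - G (- n%:R).
  move=> n0; rewrite /f_ -Rintegral_mkcond /Rintegral.
  rewrite (continuous_FTC2 (F := G))//.
  - by rewrite (@lt_trans _ _ 0)// ?oppr_lt0 ltr0n.
  - exact: continuous_subspaceT.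
  - split.
    + by move=> x _; have [] := dG x.
    + have [D _] := dG (- n%:R).
      by apply/cvg_at_right_filter/differentiable_continuous/derivable1_diffP.
    + have [D _] := dG n%:R.
      by apply/cvg_at_left_filter/differentiable_continuous/derivable1_diffP.
  - by move=> x _; rewrite derive1E; have [] := dG x.
have mf n : measurable_fun setT (EFin \o f_ n).
  apply/measurable_EFinP/(measurable_restrictT _ _).1 => //.
  exact: measurable_funTS.
have mg' : measurable_fun setT (EFin \o g) by exact/measurable_EFinP.
have f_g : {ae mu, forall x, setT x -> (EFin \o f_ n) x @[n --> \oo] --> (EFin \o g) x}.
  apply/aeW => x _; apply: cvg_near_cst.
  exists (Num.truncn `|x|).+1 => // n /= xn.
  rewrite /f_ patchE mem_set//= in_itv/= -ler_norml ltW//.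
  by apply: lt_le_trans (truncnS_gt _) _; rewrite ler_nat.
have dom : {ae mu, forall x n, setT x -> (`|(EFin \o f_ n) x| <= (abse \o (EFin \o g)) x)%E}.
  apply/aeW => x n _; rewrite /= lee_fin /f_ patchE; case: ifP => // _.
  by rewrite normr0.
have [_ _ cv] := @dominated_convergence _ _ _ mu _ measurableT
  (fun n => EFin \o f_ n) _ (abse \o (EFin \o g)) mf mg' f_g (integrable_abse ig) dom.
have cv2 : \int[mu]_x (f_ n x) @[n --> \oo] --> \int[mu]_x g x.
  apply: fine_cvg; rewrite /Rintegral fineK//.
  exact: integrable_fin_num.
have : \int[mu]_x (f_ n x) @[n --> \oo] --> 0.
  apply: cvg_trans G0; apply: near_eq_cvg; near=> n.
  by rewrite f_E//; near: n; exists 1%N.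
exact: cvg_unique.
Unshelve. all: by end_near. Qed.

End derive_lemmas.

Section normal_cos.
Context {R : realType}.
Variables (sigma : R) (sigma0 : sigma != 0).
Notation mu := (@lebesgue_measure R).
Let p := normal_pdf 0 sigma : R -> R.
Let v := sigma ^+ 2.

Let v0 : 0 < v. Proof. by rewrite exprn_even_gt0. Qed.

Let pE x : p x = normal_peak sigma * expR (- (x ^+ 2 / (2 * v))).
Proof.
rewrite /p normal_pdfE// /normal_fun subr0; congr (_ * expR _).
by rewrite mulNr -[_ *+ 2]mulr_natl.
Qed.

Let p_ge0 x : 0 <= p x. Proof. exact: normal_pdf_ge0. Qed.

(** A normal density of twice the variance absorbs the factor [x], providing an integrable
    dominating function. *)
Let sigma2 := Num.sqrt 2 * sigma.
Let sigma20 : sigma2 != 0.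
Proof. by rewrite mulf_neq0// sqrtr_eq0 -ltNge. Qed.

Let C := (1 + 4 * v) * normal_peak sigma / normal_peak sigma2.

(** With [y = x^2 / (4 v)], one has [|x| <= 1 + 4 v y <= (1 + 4 v) (1 + y) <= (1 + 4 v) exp y], and
    [exp y] cancels half of the exponent [2 y] of [p]. *)
Let xp_le x : `|x| * p x <= C * normal_pdf 0 sigma2 x.
Proof.
have -> : normal_pdf 0 sigma2 x = normal_peak sigma2 * expR (- (x ^+ 2 / (4 * v))).
  rewrite normal_pdfE// /normal_fun subr0; congr (_ * expR _).
  rewrite mulNr -[_ *+ 2]mulr_natl /sigma2 exprMn sqr_sqrtr// mulrA.
  by congr (- (_ / (_ * _))); rewrite -natrM.
have pk2 : normal_peak sigma2 != 0 by rewrite gt_eqF// normal_peak_gt0.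
set y := x ^+ 2 / (4 * v).
have -> : C * (normal_peak sigma2 * expR (- y)) =
    normal_peak sigma * ((1 + 4 * v) * expR (- y)) by rewrite /C; field.
rewrite pE mulrCA ler_wpM2l ?normal_peak_ge0//.
have -> : x ^+ 2 / (2 * v) = y + y by rewrite /y; field; rewrite gt_eqF.
rewrite opprD expRD mulrA ler_wpM2r ?expR_ge0// expRN ler_pdivrMr ?expR_gt0//.
have y0 : 0 <= y by rewrite divr_ge0 ?sqr_ge0// mulr_ge0// ltW.
have H := expR_ge1Dx y.
have : `|x| <= 1 + `|x| ^+ 2 by have := sqr_ge0 (`|x| - 1); have := normr_ge0 x; nra.
rewrite real_normK ?num_real// => /le_trans; apply.
have -> : x ^+ 2 = 4 * v * y by rewrite /y; field; rewrite gt_eqF.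
have := v0; nra.
Qed.

Let mp : measurable_fun setT p. Proof. exact: measurable_normal_pdf. Qed.

Let int_p : mu.-integrable setT (EFin \o p).
Proof. exact: integrable_normal_pdf. Qed.

Let int_dom : mu.-integrable setT (EFin \o (fun x => C * normal_pdf 0 sigma2 x)).
Proof.
rewrite (_ : _ \o _ = (fun x => C%:E * (normal_pdf 0 sigma2 x)%:E)%E).
  exact/integrableZl/integrable_normal_pdf.
by apply/funext => x; rewrite /= EFinM.
Qed.

Let int_bnd (f : R -> R) : measurable_fun setT f -> (forall x, `|f x| <= 1) ->
  mu.-integrable setT (EFin \o (fun x => p x * f x)).
Proof.
move=> mf f1; apply: le_integrable int_p => //.
  by apply/measurable_EFinP; exact: measurable_funM.
by move=> x _; rewrite /= lee_fin normrM ler_piMr.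
Qed.

Let int_xbnd (f : R -> R) : measurable_fun setT f -> (forall x, `|f x| <= 1) ->
  mu.-integrable setT (EFin \o (fun x => x * p x * f x)).
Proof.
move=> mf f1; apply: le_integrable int_dom => //.
  by apply/measurable_EFinP; do 2 apply: measurable_funM => //.
move=> x _; rewrite /= lee_fin normrM (le_trans (ler_piMr _ (f1 x)))//.
rewrite normrM [ `|p x|]ger0_norm// (le_trans (xp_le x))//.
exact: ler_norm.
Qed.

Let m_affine t s : measurable_fun setT (fun x : R => t * x + s).
Proof. by apply: measurable_funD => //; exact: measurable_funM. Qed.

Let m_sin t s : measurable_fun setT (fun x : R => sin (t * x + s)).
Proof.
apply: measurableT_comp (m_affine t s).
by apply: continuous_measurable_fun; exact: continuous_sin.
Qed.

Let m_cos t s : measurable_fun setT (fun x : R => cos (t * x + s)).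
Proof.
apply: measurableT_comp (m_affine t s).
by apply: continuous_measurable_fun; exact: continuous_cos.
Qed.

Let phi s t := \int[mu]_x (p x * cos (t * x + s)).

Let dp x : is_derive x (1 : R) p (- (x / v) * p x).
Proof.
pose k := - (2 * v)^-1.
have pk : p = (fun z => normal_peak sigma * expR (k * z ^+ 2)).
  by apply/funext => z; rewrite pE; congr (_ * expR _); rewrite /k; ring.
have dE := @is_derive1_comp R expR (fun z => k * z ^+ 2) x _ _ (is_derive_expR _) (is_derive_scale_sqr k x).
rewrite [X in is_derive _ _ X _]pk.
apply: is_derive_eq (is_derive_mulr (is_derive_cst (normal_peak sigma) x 1) dE) _.
by rewrite pk /cst /k; field; rewrite gt_eqF.
Qed.

Let cp : continuous p. Proof. exact: continuous_normal_pdf. Qed.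

Let d_cos s t x : is_derive t (1 : R) (fun t => cos (t * x + s)) (- x * sin (t * x + s)).
Proof.
have H : is_derive t (1 : R) (fun z => z * x + s) x.
  have -> : (fun z => z * x + s) = (fun z => x * z + s).
    by apply/funext => z; rewrite mulrC.
  exact: is_derive_affine.
apply: is_derive_eq (@is_derive1_comp R cos (fun z => z * x + s) t _ _ (is_derive_cos _) H) _.
by rewrite mulNr mulrC mulNr.
Qed.

(** Differentiation under the integral sign; the derivative in [t] is at most [|x| * p x] in
    absolute value, uniformly in [t]. *)
Let dphi s t : is_derive t (1 : R) (phi s) (- \int[mu]_x (x * p x * sin (t * x + s))).
Proof.
pose f (t x : R) := p x * cos (t * x + s).
pose D x := C * normal_pdf 0 sigma2 x.
have d1 t' x : is_derive t' (1 : R) (f^~ x) (- (x * p x * sin (t' * x + s))).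
  have H := is_derive_mulr (is_derive_cst (p x) t' 1) (d_cos s t' x).
  by apply: is_derive_eq H _; rewrite /cst; ring.
have tI : [set` `](t - 1), (t + 1)[] t by rewrite /= in_itv/= ltrBlDr ltrDl ltr01.
have int_f t' : [set` `](t - 1), (t + 1)[] t' -> mu.-integrable setT (EFin \o f t').
  by move=> _; apply: int_bnd => // x; exact: cos_max.
have der_f t' x : [set` `](t - 1), (t + 1)[] t' -> setT x -> derivable (f^~ x) t' 1.
  by move=> _ _; have [] := d1 t' x.
have D0 x : 0 <= D x by apply: le_trans (xp_le x); rewrite mulr_ge0.
have f_D t' x : [set` `](t - 1), (t + 1)[] t' -> setT x -> `|partial1of2 f t' x| <= D x.
  move=> _ _; rewrite /partial1of2 derive1E; have [_ ->] := d1 t' x.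
  rewrite normrN normrM (le_trans (ler_piMr _ (sin_max _)))//.
  by rewrite normrM [ `|p x|]ger0_norm.
apply: DeriveDef.
  exact: (derivable_under_integral measurableT tI int_f der_f D0 int_dom f_D).
rewrite -derive1E.
rewrite (differentiation_under_integral measurableT tI int_f der_f D0 int_dom f_D).
rewrite -[RHS]mulN1r -RintegralZl//; last first.
  by apply: int_xbnd => // x; exact: sin_max.
apply: eq_Rintegral => x _; rewrite /partial1of2 derive1E; have [_ ->] := d1 t x.
by rewrite mulN1r.
Qed.

(** Boundary terms of the integration by parts: [|x| * p x] is bounded, so they are of order
    [1 / n]. *)
Let G_cvg0 s t : p n%:R * sin (t * n%:R + s) - p (- n%:R) * sin (t * - n%:R + s)
  @[n --> \oo] --> 0.
Proof.
pose M := 2 * (C * normal_peak sigma2).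
have pM x : `|x| * p x <= C * normal_peak sigma2.
  have C0 : 0 <= C.
    by rewrite divr_ge0 ?normal_peak_ge0// mulr_ge0 ?normal_peak_ge0// addr_ge0// mulr_ge0// ltW.
  by rewrite (le_trans (xp_le x))// ler_wpM2l// normal_pdf_ub.
apply: norm_cvg0; apply: (@squeeze_cvgr _ _ _ _ (fun=> 0) (fun n => M / n%:R)).
- near=> n; rewrite normr_ge0/=.
  have n0 : 0 < n%:R :> R by rewrite ltr0n; near: n; exists 1%N.
  rewrite ler_pdivlMr// mulrC (le_trans (ler_wpM2l (ltW n0) (ler_normB _ _)))//.
  rewrite mulrDr !normrM /M mulr_natl mulr2n; apply: lerD.
    rewrite mulrA (le_trans (ler_piMr _ (sin_max _)))// ?(mulr_ge0 (ltW n0))//.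
    by rewrite [ `|p _|]ger0_norm//; have := pM n%:R; rewrite (ger0_norm (ltW n0)).
  rewrite mulrA (le_trans (ler_piMr _ (sin_max _)))// ?(mulr_ge0 (ltW n0))//.
  by rewrite [ `|p _|]ger0_norm//; have := pM (- n%:R); rewrite normrN (ger0_norm (ltW n0)).
- exact: cvg_cst.
- rewrite -[X in _ --> X](mulr0 M); apply: cvgM; first exact: cvg_cst.
  exact: inv_nat_cvg0.
Unshelve. all: by end_near. Qed.

(** Since [p' = - (x / v) p], the derivative of [p * sin] combines both integrands, and its total
    integral is zero. *)
Let by_parts s t : \int[mu]_x (x * p x * sin (t * x + s)) = v * t * phi s t.
Proof.
pose G x := p x * sin (t * x + s).
pose g x := t * (p x * cos (t * x + s)) - v^-1 * (x * p x * sin (t * x + s)).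
have dG x : is_derive x (1 : R) G (g x).
  have H := @is_derive1_comp R sin (fun z => t * z + s) x _ _ (is_derive_sin _) (is_derive_affine t s x).
  by apply: is_derive_eq (is_derive_mulr (dp x) H) _; rewrite /g /=; ring.
have ip : mu.-integrable setT (EFin \o (fun x => p x * cos (t * x + s))).
  by apply: int_bnd => // x; exact: cos_max.
have ix : mu.-integrable setT (EFin \o (fun x => x * p x * sin (t * x + s))).
  by apply: int_xbnd => // x; exact: sin_max.
have c_aff : continuous (fun x : R => t * x + s).
  by move=> x; apply: cvgD; [apply: cvgM; [exact: cvg_cst|exact: cvg_id]|exact: cvg_cst].
have cg : continuous g.
  move=> x; apply: cvgB; (apply: cvgM; first exact: cvg_cst).
    apply: cvgM; first exact: cp.
    by apply: continuous_comp; [exact: c_aff|exact: continuous_cos].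
  apply: cvgM; first by apply: cvgM; [exact: cvg_id|exact: cp].
  by apply: continuous_comp; [exact: c_aff|exact: continuous_sin].
have ip' : mu.-integrable setT (EFin \o (fun x => t * (p x * cos (t * x + s)))).
  by rewrite (_ : _ \o _ = (fun x => t%:E * (p x * cos (t * x + s))%:E)%E)//;
    exact: integrableZl.
have ix' : mu.-integrable setT (EFin \o (fun x => v^-1 * (x * p x * sin (t * x + s)))).
  by rewrite (_ : _ \o _ = (fun x => v^-1%:E * (x * p x * sin (t * x + s))%:E)%E)//;
    exact: integrableZl.
have ig : mu.-integrable setT (EFin \o g).
  rewrite (_ : EFin \o g = ((EFin \o (fun x => t * (p x * cos (t * x + s)))%R) \-
    (EFin \o (fun x => v^-1 * (x * p x * sin (t * x + s)))%R))%E)//.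
  exact: integrableB.
have := integral_derive_eq0 dG cg ig (G_cvg0 s t).
rewrite RintegralB// !RintegralZl// => /eqP; rewrite subr_eq0 => /eqP /(congr1 ( *%R v)).
by rewrite mulVKf ?gt_eqF// => <-; rewrite mulrA.
Qed.

(* [phi s] satisfies the differential equation [phi' = - v t phi] *)
Lemma normal_cos s t :
  \int[mu]_x (p x * cos (t * x + s)) = expR (- (t ^+ 2 * v / 2)) * cos s.
Proof.
(* Integrating factor: [phi s * E] has derivative 0, hence equals its value at [t = 0], which is
   [cos s]. *)
pose E (t : R) := expR (v / 2 * t ^+ 2).
have dE z : is_derive z (1 : R) E (E z * (2 * (v / 2) * z)).
  exact: @is_derive1_comp R expR (fun z => v / 2 * z ^+ 2) z _ _ (is_derive_expR _) (is_derive_scale_sqr _ z).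
have dpsi z : is_derive z (1 : R) (fun z => phi s z * E z) 0.
  apply: is_derive_eq (is_derive_mulr (dphi s z) (dE z)) _.
  by rewrite by_parts; field.
have := ler_dist_derive1 t 0 dpsi (fun=> eq_ind _ (fun x => x <= 0) (lexx 0) _ (esym (normr0 _))).
rewrite mul0r normr_le0 subr_eq0 => /eqP H.
have phi0 : phi s 0 = cos s.
  rewrite /phi; under eq_Rintegral do rewrite mul0r add0r.
  rewrite RintegralZr//; suff -> : \int[mu]_x p x = 1 by rewrite mul1r.
  by rewrite /Rintegral (integral_normal_pdf 0 sigma).
rewrite phi0 {2}/E expr0n/= mulr0 expR0 mulr1 in H.
rewrite -H mulrCA -expRD -[LHS]mulr1; congr (_ * _).
by rewrite -expR0; congr expR; ring.
Qed.

End normal_cos.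

Section normal_law_cos.
Context {R : realType}.
Local Notation mu := (@lebesgue_measure R).

Lemma integral_normal_prob (m sigma : R) (f : R -> \bar R) : sigma != 0 ->
  (normal_prob m sigma).-integrable setT f ->
  (\int[normal_prob m sigma]_x f x = \int[mu]_x (f x * (normal_pdf m sigma x)%:E))%E.
Proof.
move=> s0 intf; have mf := measurable_int _ intf.
have dom := normal_prob_dominates m sigma.
rewrite -(Radon_Nikodym_change_of_variables dom)//=.
apply: ae_eq_integral => //.
- exact: emeasurable_funM.
- apply: emeasurable_funM => //; apply/measurable_EFinP.
  exact: measurable_normal_pdf.
- apply: ae_eqe_mul2l => /=.
  rewrite Radon_NikodymE//=.
  case: cid => /= h [h1 h2 h3].
  apply: integral_ae_eq => //=.
    by apply/measurable_EFinP; exact: measurable_normal_pdf.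
  by move=> E _ mE; rewrite -h3.
Qed.

Lemma measurable_cos_affine (t s : R) : measurable_fun setT (fun x => cos (t * x + s)).
Proof.
apply: (measurableT_comp (f := @cos R)).
  by apply: continuous_measurable_fun; exact: continuous_cos.
by apply: measurable_funD => //; exact: measurable_funM.
Qed.

Lemma normal_law_cos (v t s : R) : 0 <= v ->
  \int[normal_law 0 v]_x cos (t * x + s) = expR (- (t ^+ 2 * v / 2)) * cos s.
Proof.
move=> v0; rewrite /normal_law; case: eqVneq => [->|vn0].
  have mc : measurable_fun setT (fun x : R => (cos (t * x + s))%:E).
    by apply/measurable_EFinP; exact: measurable_cos_affine.
  have := integral_dirac (0 : measurableTypeR R) measurableT mc.
  rewrite diracT mul1e mulr0 add0r => H.
  by rewrite /Rintegral [X in fine X]H /= mulr0 mul0r oppr0 expR0 mul1r.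
have s0 : Num.sqrt v != 0 by rewrite sqrtr_eq0 -ltNge lt_neqAle eq_sym vn0.
rewrite /Rintegral integral_normal_prob//; last first.
  apply: measurable_bounded_integrable => //.
  - by rewrite (le_lt_trans (probability_le1 _ _))// ltry.
  - exact: measurable_cos_affine.
  - exists 1; split => // M M1 x _ /=.
    by rewrite (le_trans (cos_max _))// ltW.
have := normal_cos s0 s t; rewrite sqr_sqrtr// => <-.
by rewrite /Rintegral; congr fine; apply: eq_integral => x _; rewrite -EFinM mulrC.
Qed.

End normal_law_cos.

(** * Square-integrable random variables *)

Section square_integrable.
Context {R : realType} d {T : measurableType d} (P : probability T R).
Implicit Types f g : T -> R.

Definition Rintegrable f := P.-integrable setT (EFin \o f).

Definition square_integrable f :=
  measurable_fun setT f /\ Rintegrable (fun t => f t ^+ 2).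

Local Notation E f := (\int[P]_t f t).

Lemma Rintegrable_measurable f : Rintegrable f -> measurable_fun setT f.
Proof. by move=> /measurable_int/measurable_EFinP. Qed.

Lemma RintegrableD f g : Rintegrable f -> Rintegrable g ->
  Rintegrable (fun t => f t + g t).
Proof. exact: integrableD. Qed.

Lemma RintegrableB f g : Rintegrable f -> Rintegrable g ->
  Rintegrable (fun t => f t - g t).
Proof. exact: integrableB. Qed.

Lemma RintegrableZ k f : Rintegrable f -> Rintegrable (fun t => k * f t).
Proof. exact: integrableZl. Qed.

Lemma Rintegrable_cst k : Rintegrable (fun=> k).
Proof. exact: (@bounded_integrable _ _ _ P _ `|k|). Qed.

Lemma Rintegrable_le f g : measurable_fun setT f -> Rintegrable g ->
  (forall t, `|f t| <= g t) -> Rintegrable f.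
Proof.
move=> mf Ig fg; apply: le_integrable Ig => //; first exact/measurable_EFinP.
by move=> t _ /=; rewrite lee_fin (le_trans (fg t))// ler_norm.
Qed.

Lemma meanB f g : Rintegrable f -> Rintegrable g ->
  E (fun t => f t - g t) = E f - E g.
Proof. exact: RintegralB. Qed.

Lemma meanD f g : Rintegrable f -> Rintegrable g ->
  E (fun t => f t + g t) = E f + E g.
Proof. exact: RintegralD. Qed.

Lemma meanZ k f : Rintegrable f -> E (fun t => k * f t) = k * E f.
Proof. exact: RintegralZl. Qed.

Lemma mean_cst k : E (fun=> k) = k.
Proof. by rewrite Rintegral_cst//= probability_setT /= mulr1. Qed.

Lemma mean_le f g : Rintegrable f -> Rintegrable g -> (forall t, f t <= g t) ->
  E f <= E g.
Proof. by move=> If Ig fg; apply: le_Rintegral => //. Qed.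

Lemma norm_mean_le f g : Rintegrable f -> Rintegrable g ->
  (forall t, `|f t| <= g t) -> `|E f| <= E g.
Proof.
move=> If Ig fg; rewrite ler_norml; apply/andP; split.
  have <- : E (fun t => -1 * g t) = - E g by rewrite meanZ// mulN1r.
  apply: mean_le => //; first exact: RintegrableZ.
  by move=> t; have := fg t; rewrite ler_norml mulN1r => /andP[].
by apply: mean_le => // t; have := fg t; rewrite ler_norml => /andP[].
Qed.

Lemma square_integrable_int f : square_integrable f -> Rintegrable f.
Proof.
move=> [mf If]; apply: (Rintegrable_le mf (RintegrableD (Rintegrable_cst 1) If)).
move=> t; rewrite -[f t ^+ 2](real_normK (num_real _)).
have := sqr_ge0 (`|f t| - 1); have := normr_ge0 (f t); nra.
Qed.

Lemma square_integrableM f g : square_integrable f -> square_integrable g ->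
  Rintegrable (fun t => f t * g t).
Proof.
move=> [mf If] [mg Ig].
apply: (Rintegrable_le _ (RintegrableD If Ig)); first exact: measurable_funM.
move=> t; rewrite normrM -[f t ^+ 2](real_normK (num_real _)).
rewrite -[g t ^+ 2](real_normK (num_real _)).
by have := sqr_ge0 (`|f t| - `|g t|); have := normr_ge0 (f t); have := normr_ge0 (g t); nra.
Qed.

Lemma square_integrableD f g : square_integrable f -> square_integrable g ->
  square_integrable (fun t => f t + g t).
Proof.
move=> Sf Sg; have [mf If] := Sf; have [mg Ig] := Sg.
split; first exact: measurable_funD.
have := RintegrableD (RintegrableD If Ig) (RintegrableZ 2 (square_integrableM Sf Sg)).
by congr Rintegrable; apply/funext => t; ring.
Qed.

Lemma square_integrableZ k f : square_integrable f ->
  square_integrable (fun t => k * f t).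
Proof.
move=> [mf If]; split; first exact: measurable_funM.
by have := RintegrableZ (k ^+ 2) If; congr Rintegrable; apply/funext => t; ring.
Qed.

Lemma square_integrable_cst k : square_integrable (fun=> k).
Proof. by split => //; exact: Rintegrable_cst. Qed.

Lemma square_integrableB f g : square_integrable f -> square_integrable g ->
  square_integrable (fun t => f t - g t).
Proof.
move=> Sf Sg; have := square_integrableD Sf (square_integrableZ (-1) Sg).
by congr square_integrable; apply/funext => t; rewrite mulN1r.
Qed.

Lemma square_integrable_sum (I : Type) (r : seq I) (f : I -> T -> R) :
  (forall i, square_integrable (f i)) ->
  square_integrable (fun t => \sum_(i <- r) f i t).
Proof.
move=> Sf; elim: r => [|i r IH].
  under eq_fun do rewrite big_nil; exact: square_integrable_cst.
under eq_fun do rewrite big_cons; exact: square_integrableD.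
Qed.

Lemma mean_sum (I : Type) (r : seq I) (f : I -> T -> R) :
  (forall i, Rintegrable (f i)) ->
  Rintegrable (fun t => \sum_(i <- r) f i t) /\
  E (fun t => \sum_(i <- r) f i t) = \sum_(i <- r) E (f i).
Proof.
move=> If; elim: r => [|i r [IH1 IH2]].
  have -> : (fun t => \sum_(i <- [::]) f i t) = (fun=> 0).
    by apply/funext => t; rewrite big_nil.
  by rewrite big_nil mean_cst; split => //; exact: Rintegrable_cst.
have -> : (fun t => \sum_(j <- i :: r) f j t) = (fun t => f i t + \sum_(j <- r) f j t).
  by apply/funext => t; rewrite big_cons.
by rewrite big_cons -IH2 meanD//; split => //; exact: RintegrableD.
Qed.

(** From [2 |f| <= e + f^2 / e]; taking [e] of the order of the L^2 norm replaces Cauchy-Schwarz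
    without square roots. *)
Lemma norm_mean_sqr_le f e : square_integrable f -> 0 < e ->
  `|E f| <= e + e^-1 * E (fun t => f t ^+ 2).
Proof.
move=> Sf e0; have [mf If] := Sf.
rewrite -[X in X + _](mean_cst e) -meanZ// -meanD; last first.
- exact: RintegrableZ.
- exact: Rintegrable_cst.
apply: norm_mean_le.
- exact: square_integrable_int.
- by apply: RintegrableD; [exact: Rintegrable_cst|exact: RintegrableZ].
move=> t; rewrite -[f t ^+ 2](real_normK (num_real _)).
have -> : e + e^-1 * `|f t| ^+ 2 = 2 * `|f t| + e^-1 * (`|f t| - e) ^+ 2.
  by field; rewrite gt_eqF.
have : 0 <= e^-1 * (`|f t| - e) ^+ 2 by rewrite mulr_ge0 ?sqr_ge0// invr_ge0 ltW.
by have := normr_ge0 (f t); lra.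
Qed.

(** Fatou's lemma for squares: uniform L^2 bounds on finite look-backs pass to their almost sure
    limit, and its square-integrability comes with them. *)
Lemma fatou_square (f_ : nat -> T -> R) (f : T -> R) (C : R) :
  (forall m, square_integrable (f_ m)) -> measurable_fun setT f ->
  {ae P, forall t, f_ m t @[m --> \oo] --> f t} ->
  (forall m, E (fun t => f_ m t ^+ 2) <= C) ->
  square_integrable f /\ E (fun t => f t ^+ 2) <= C.
Proof.
move=> Sf mf cf EC.
have mf2 m : measurable_fun setT (fun t => (f_ m t ^+ 2)%:E).
  by have [/measurable_funX mfm _] := Sf m; exact/measurable_EFinP.
have H : (\int[P]_t (f t ^+ 2)%:E <= C%:E)%E.
  have mF : measurable_fun setT (fun t => limn_einf (fun m => (f_ m t ^+ 2)%:E)).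
    rewrite /limn_einf; apply: measurableT_comp => //.
    apply: (@measurable_fun_limn_esup _ _ _ _ (fun m t => (- (f_ m t ^+ 2)%:E)%E)).
    by move=> m; exact: measurableT_comp.
  apply: (@le_trans _ _ (\int[P]_t limn_einf (fun m => (f_ m t ^+ 2)%:E))%E).
    apply: ae_ge0_le_integral => //.
    - by move=> t _; rewrite lee_fin sqr_ge0.
    - by apply/measurable_EFinP/measurable_funX.
    - move=> t _; rewrite limn_einf_lim; apply: lime_ge; first exact: is_cvg_einfs.
      by apply: nearW => n; apply: le_ereal_inf_tmp => _ [k _ <-]; rewrite lee_fin sqr_ge0.
    apply: filterS cf => t ft _.
    have cu : (f_ m t ^+ 2)%:E @[m --> \oo] --> (f t ^+ 2)%:E.
      apply: cvg_EFin; first exact: nearW.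
      rewrite expr2 (_ : _ \o _ = (fun m => f_ m t * f_ m t)); first exact: cvgM.
      by apply/funext => m; rewrite /= expr2.
    by rewrite (cvg_limn_einf_sup cu).1.
  apply: le_trans (fatou _ _ _ _) _ => //.
    by move=> m t _; rewrite lee_fin sqr_ge0.
  rewrite limn_einf_lim; apply: lime_le; first exact: is_cvg_einfs.
  apply: nearW => n; apply: (@le_trans _ _ (\int[P]_t (f_ n t ^+ 2)%:E)%E).
    by apply: ereal_inf_lbound; exists n => /=.
  have [_ Ifn] := Sf n.
  by rewrite -[leLHS]fineK ?lee_fin ?EC//; exact: integrable_fin_num.
have If2 : Rintegrable (fun t => f t ^+ 2).
  apply/integrableP; split; first exact/measurable_EFinP/measurable_funX.
  under eq_integral do rewrite /= ger0_norm ?sqr_ge0//.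
  by rewrite (le_lt_trans H)// ltry.
split => //; rewrite -lee_fin fineK//; exact: integrable_fin_num.
Qed.

End square_integrable.

(** * The block process *)

Section word_average_tuple.
Context {R : realType} {A : finType}.
Implicit Types F : seq A -> R.

Lemma sum_tupleS n F :
  \sum_(s : n.+1.-tuple A) F s = \sum_(x : A) \sum_(s : n.-tuple A) F (x :: s).
Proof.
rewrite pair_big /=.
rewrite (reindex (fun p : A * n.-tuple A => [tuple of p.1 :: p.2])) /=.
  by apply: eq_bigr => -[x s] _.
exists (fun s => (thead s, [tuple of behead s])) => [[x s] _|s _] /=.
  by congr pair; apply: val_inj.
by rewrite [RHS]tuple_eta; apply: val_inj.
Qed.

Lemma word_mean_tuple n F : word_mean n F = #|A|%:R^-1 ^+ n * \sum_(s : n.-tuple A) F s.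
Proof.
elim: n F => [|n IH] F.
  rewrite mul1r (bigD1 [tuple]) //= big1 ?addr0// => s /eqP sn.
  by case: sn; exact: tuple0.
rewrite sum_tupleS /word_mean -/word_mean; under eq_bigr => x _ do rewrite IH.
by rewrite -mulr_sumr mulrA -exprS.
Qed.

Lemma word_mean_notin n (x : A) : (0 < #|A|)%N ->
  word_mean n (fun s => (x \notin s)%:R) = (1 - #|A|%:R^-1) ^+ n :> R.
Proof.
move=> A0; elim: n => [//|n IH].
rewrite (@word_mean_first_letter _ _ A0 _ x 0 _ (fun s => (x \notin s)%:R)).
- by rewrite mulr0 add0r IH exprS.
- by move=> s; rewrite inE eqxx.
- by move=> y s yx; rewrite inE eq_sym (negbTE yx).
Qed.

End word_average_tuple.

Section window.
Context {L : nat} {R : realType} {d : measure_display} {T : measurableType d}.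
Context (P : probability T R) (b : int -> {RV P >-> L.-tuple bool}).
Hypothesis hb : iid_uniform_blocks P b.
Local Notation A := (L.-tuple bool).
Implicit Types (F : seq A -> R) (n : int) (m : nat).

Definition window n m (t : T) : seq A := mkseq (fun i => b (n - i%:Z) t) m.

Lemma size_window n m t : size (window n m t) = m.
Proof. by rewrite size_mkseq. Qed.

Lemma windowS n m t : window n m.+1 t = b n t :: window (n - 1) m t.
Proof.
rewrite /window /mkseq /= subr0 -[1%N]addn0 iotaDl -map_comp.
by congr cons; apply: eq_map => i /=; congr (b _ t); rewrite PoszD opprD addrA.
Qed.

Lemma take_window n k m t : (k <= m)%N -> take k (window n m t) = window n k t.
Proof. by move=> km; rewrite /window /mkseq -map_take take_iota (minn_idPl km). Qed.

Lemma card_blocks : #|{: A}| = (2 ^ L)%N.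
Proof. by rewrite card_tuple card_bool. Qed.

Let letter n (x : A) : P (b n @^-1` [set x]) = (#|{: A}|%:R^-1)%:E.
Proof. by rewrite card_blocks natrX; have [_ /(_ n x)] := hb. Qed.

(** Independence is stated over finite sets of integer times, so the event is written over the set
    of times; [absz (n - i)] recovers the position in the word from the time [i]. *)
Lemma window_setE n m (s : m.-tuple A) :
  [set t | window n m t = s] =
  \bigcap_(i in [set` [fset (n - (@nat_of_ord m k)%:Z) | k in 'I_m]%fset])
    (b i @^-1` [set nth [tuple of nseq L false] s (absz (n - i)%R)]).
Proof.
have dist (k : nat) : absz (n - (n - k%:Z))%R = k by rewrite opprB addrC subrK.
apply/seteqP; split => [t /= ts i /imfsetP[k _ ->]|t /= tb].
  by rewrite /preimage /= -ts dist nth_mkseq.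
apply: (@eq_from_nth _ [tuple of nseq L false]); rewrite size_mkseq ?size_tuple// => i im.
rewrite nth_mkseq//.
have -> : b (n - i%:Z) t = nth [tuple of nseq L false] s (absz (n - (n - i%:Z))%R).
  by apply: tb; apply/imfsetP; exists (Ordinal im).
by rewrite dist.
Qed.

Lemma window_law n m (s : m.-tuple A) :
  P [set t | window n m t = s] = ((#|{: A}|%:R^-1) ^+ m)%:E.
Proof.
rewrite window_setE; have [ind _] := hb; rewrite ind; last first.
  by move=> i _; exact: measurable_tuple_bool_set1.
under eq_bigr do rewrite letter.
rewrite prodEFin; congr EFin.
rewrite big_const_seq count_predT iter_mulr_1; congr (_ ^+ _).
rewrite (_ : size _ = #|` [fset (n - (@nat_of_ord m k)%:Z) | k in 'I_m]%fset|)//.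
rewrite card_imfset/= ?size_enum_ord// => i j /addrI /oppr_inj [ij].
by apply: ord_inj.
Qed.

Lemma measurable_window n m (s : m.-tuple A) : measurable [set t | window n m t = s].
Proof.
rewrite window_setE; apply: fin_bigcap_measurable.
  exact: finite_fset.
by move=> i _; apply: measurable_funPTI; exact: measurable_tuple_bool_set1.
Qed.

Let windowE F n m t :
  F (window n m t) = \sum_(s : m.-tuple A) F s * \1_[set t | window n m t = s] t.
Proof.
have sz : size (window n m t) == m by rewrite size_window.
rewrite (bigD1 (Tuple sz))//= indicE mem_set// mulr1 big1 ?addr0// => s sn.
rewrite indicE memNset ?mulr0//= => ts; move/negP : sn; apply.
by apply/eqP/val_inj.
Qed.

(** Transfers the word estimates to the probability space: a function of finitely many consecutive
    blocks is integrable, with a mean that does not depend on their position [n]. *)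
Lemma window_integral F n m : Rintegrable P (fun t => F (window n m t)) /\
  \int[P]_t F (window n m t) = word_mean m F.
Proof.
have I1 (s : m.-tuple A) : Rintegrable P (\1_[set t | window n m t = s] : T -> R).
  apply: (@bounded_integrable _ _ _ P _ 1).
    by apply: measurable_indic; exact: measurable_window.
  by move=> x; rewrite indicE; case: (_ \in _); rewrite ?normr1 ?normr0.
have I2 (s : m.-tuple A) := RintegrableZ (F s) (I1 s).
have [I3 E3] := mean_sum (index_enum (m.-tuple A)) I2.
rewrite (_ : (fun t => F (window n m t)) =
   (fun t => \sum_(s : m.-tuple A) F s * \1_[set t | window n m t = s] t)); last first.
  by apply/funext => t; exact: windowE.
split => //; rewrite E3 word_mean_tuple mulr_sumr; apply: eq_bigr => s _.
rewrite meanZ// mulrC; congr (_ * _).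
rewrite /Rintegral integral_indic//; last exact: measurable_window.
by rewrite setIT; exact: (congr1 fine (window_law n s)).
Qed.

Lemma window_square_integrable F n m :
  square_integrable P (fun t => F (window n m t)).
Proof.
split; first by have [/Rintegrable_measurable] := window_integral F n m.
by have [] := window_integral (fun s => F s ^+ 2) n m.
Qed.

End window.

Section weighted_sums.
Context {R : realType}.

(** With geometric weights it bounds the square of a sum of geometrically small terms uniformly in
    their number. *)
Lemma weighted_cauchy_schwarz (w a : nat -> R) K : (forall i, 0 < w i) ->
  (\sum_(i < K) a i) ^+ 2 <= (\sum_(i < K) w i) * (\sum_(i < K) a i ^+ 2 / w i).
Proof.
move=> w0; elim: K => [|K IH]; first by rewrite !big_ord0 mul0r expr0n.
rewrite !big_ord_recr /=.
set S := \sum_(i < K) a i in IH *; set W := \sum_(i < K) w i in IH *.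
set Q := \sum_(i < K) _ / _ in IH *.
have W0 : 0 <= W by apply: sumr_ge0 => i _; rewrite ltW.
have Q0 : 0 <= Q by apply: sumr_ge0 => i _; rewrite divr_ge0 ?sqr_ge0 ?ltW.
have wK := w0 K; set x := a K; set u := w K in wK *.
have H : 2 * (x * S) <= W * (x ^+ 2 / u) + u * Q.
  have [W00|W00] := eqVneq W 0.
    have -> : S = 0 by apply/eqP; rewrite -sqrf_eq0 eq_le sqr_ge0 andbT -[leRHS](mul0r Q) -W00.
    by rewrite !mulr0 W00 mul0r add0r mulr_ge0// ltW.
  have Wp : 0 < W by rewrite lt_neqAle eq_sym W00.
  have -> : 2 * (x * S) = W * (x ^+ 2 / u) + u * (S ^+ 2 / W) -
      (W * x - u * S) ^+ 2 / (u * W) by field; rewrite W00 gt_eqF.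
  rewrite -addrA lerD2l lerBlDr (@le_trans _ _ (u * Q))//; last first.
    by rewrite lerDl divr_ge0 ?sqr_ge0// mulr_ge0// ltW.
  by rewrite ler_wpM2l ?(ltW wK)// ler_pdivrMr// mulrC.
have -> : (W + u) * (Q + x ^+ 2 / u) = W * Q + (W * (x ^+ 2 / u) + u * Q) + x ^+ 2.
  by field; rewrite gt_eqF.
by move: H IH; rewrite sqrrD -mulr_natl; lra.
Qed.

Lemma sum_geometric_le (g : R) K : 0 <= g -> g < 1 ->
  \sum_(i < K) g ^+ i <= (1 - g)^-1.
Proof.
move=> g0 g1; have g1' : 0 < 1 - g by rewrite subr_gt0.
rewrite -[leRHS]mul1r ler_pdivlMr// mulrC.
suff -> : (1 - g) * \sum_(i < K) g ^+ i = 1 - g ^+ K by rewrite gerBl exprn_ge0.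
elim: K => [|K IH]; first by rewrite big_ord0 mulr0 subrr.
by rewrite big_ord_recr/= mulrDr IH exprS; ring.
Qed.

End weighted_sums.

(** * Comparison of the stationary sums with sums over finite words *)

Section stationary_sums.
Context {L : nat} (hL : (1 <= L)%N).
Context {R : realType} {d : measure_display} {T : measurableType d}.
Context (P : probability T R) (b : int -> {RV P >-> L.-tuple bool}).
Hypothesis hb : iid_uniform_blocks P b.
Local Notation A := (L.-tuple bool).
Local Notation window := (window b).
Local Notation E f := (\int[P]_t f t).
Local Notation X := (Xvar R b).

(** An index counts from 0 and a recurrence time from 1, hence the shift. *)
Let h (i : nat) : R := gfun R i.+1.
Let c : R := (ln 2)^-1.

Let h_incr n : 0 <= h n.+1 - h n <= c.
Proof.
have c0 : 0 < c by rewrite invr_gt0 ln_gt0// ltr1n.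
have -> : h n.+1 - h n = c * n.+1%:R^-1.
  by rewrite /h /gfun [in X in X - _]big_nat_recr//= mulrDr addrC addKr.
rewrite mulr_ge0 ?(ltW c0) ?invr_ge0//= ler_piMr ?(ltW c0)//.
by rewrite invf_le1 ?ltr0n// ler1n.
Qed.

Let A1 : (1 < #|{: A}|)%N.
Proof. by rewrite card_blocks -{1}(expn0 2) ltn_exp2l. Qed.

Let A0 : (0 < #|{: A}|)%N. Proof. exact: ltnW. Qed.

Let gain : seq A -> R := recurrence_gain h.
Let Z : seq A -> R := suffix_sum gain.
Let gam : R := Num.sqrt (1 - #|{: A}|%:R^-1).
Let C : R := 2 * c ^+ 2 * #|{: A}|%:R ^+ 2.

Let C0 : 0 <= C. Proof. by rewrite /C mulr_ge0 ?sqr_ge0// mulr_ge0 ?sqr_ge0. Qed.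

Let rho_gt0 : 0 < 1 - #|{: A}|%:R^-1 :> R.
Proof. by rewrite subr_gt0 invf_lt1 ?ltr1n// ltr0n. Qed.

Let gam_gt0 : 0 < gam. Proof. by rewrite sqrtr_gt0. Qed.

Let gam_lt1 : gam < 1.
Proof. by rewrite -[ltRHS]sqrtr1 ltr_sqrt// ltrBlDr ltrDl invr_gt0 ltr0n. Qed.

(** The gain at time [n] with look-back limited to [m] earlier blocks; the window has one more
    letter, the block at [n] itself. *)
Let Xt (n m : nat) t := gain (window n%:Z m.+1 t).

Lemma Xvar_eventually n t : (exists m, recurs_at (fun k => b k t) n%:Z m) ->
  exists M, forall m, (M <= m)%N -> Xt n m t = X n t.
Proof.
move=> hex; rewrite /Xvar /Avar /recurrence_time.
case: pselect => // hex'; case: ex_minnP => a /andP[a0 /eqP ba] amin.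
exists a => m am; rewrite /Xt windowS /gain /recurrence_gain /h.
set s := window _ _ _; set x := b n%:Z t.
have nthE i : (i < m)%N -> nth x s i = b (n%:Z - i.+1%:Z) t.
  by move=> im; rewrite nth_mkseq//; congr (b _ t); lia.
congr (gfun R _).
have am1 : (a.-1 < m)%N by rewrite prednK.
have xa : nth x s a.-1 = x by rewrite nthE// prednK.
have xs : x \in s by rewrite -xa mem_nth// size_window.
have im : (index x s < m)%N by rewrite -[m](size_window b (n%:Z - 1) m t) index_mem.
apply/eqP; rewrite eqn_leq; apply/andP; split.
  rewrite -(prednK a0) ltnS leqNgt; apply/negP => /(before_find x).
  by rewrite xa /= eqxx.
by apply: amin; rewrite /recurs_at /= -nthE// nth_index.
Qed.

(** Having no recurrence implies none among the first [m] earlier blocks, an event of probability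
    [rho ^+ m] for every [m]. *)
Lemma ae_recurs n : {ae P, forall t, exists m, recurs_at (fun k => b k t) n%:Z m}.
Proof.
pose B := \bigcup_m [set t | recurs_at (fun k => b k t) n%:Z m].
have mB : measurable B by apply: bigcup_measurable => m _; exact: measurable_recurs_at.
exists (~` B); split; first exact: measurableC.
  pose F (s : seq A) : R := if s is x :: s' then (x \notin s')%:R else 0.
  have H m : fine (P (~` B)) <= (1 - #|{: A}|%:R^-1) ^+ m.
    have [IF EF] := window_integral hb F n%:Z m.+1.
    have I1 : Rintegrable P (\1_(~` B) : T -> R).
      apply: (@bounded_integrable _ _ _ P _ 1).
        by apply: measurable_indic; exact: measurableC.
      by move=> x; rewrite indicE; case: (_ \in _); rewrite ?normr1 ?normr0.
    have -> : fine (P (~` B)) = E (\1_(~` B) : T -> R).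
      by rewrite /Rintegral integral_indic ?setIT//; exact: measurableC.
    apply: (@le_trans _ _ (E (fun t => F (window n%:Z m.+1 t)))).
      apply: mean_le => // t; rewrite indicE windowS /=.
      have [|_] := boolP (t \in ~` B); last by rewrite ler0n.
      rewrite inE => nB; rewrite [_ \notin _](_ : _ = true)//.
      apply/negP => /(nthP (b n%:Z t))[i]; rewrite size_window => im.
      rewrite nth_mkseq// => bi; apply: nB; exists i.+1 => //=.
      rewrite /recurs_at /= -bi.
      by apply/eqP; congr (b _ t); lia.
    rewrite EF; apply: (word_mean_first_le A0) => x.
    by rewrite /F word_mean_notin.
  have cv : (1 - #|{: A}|%:R^-1 : R) ^+ m @[m --> \oo] --> (0 : R).
    apply: cvg_expr; rewrite ger0_norm ?(ltW rho_gt0)//.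
    by rewrite ltrBlDr ltrDl invr_gt0 ltr0n.
  have fP : P (~` B) \is a fin_num by apply: fin_num_measure; exact: measurableC.
  rewrite -(fineK fP); congr EFin; apply/eqP; rewrite eq_le fine_ge0 ?andbT//.
  rewrite -(cvg_lim _ cv)//; apply: limr_ge; first by apply/cvg_ex; exists 0.
  exact: nearW.
by apply: subsetC => t /= [m _ /= Hm]; exists m.
Qed.

Lemma measurable_X n : measurable_fun setT (X n). Proof. exact: measurable_Xvar. Qed.

Let Xt_sq n m : square_integrable P (Xt n m).
Proof. exact: window_square_integrable. Qed.

(** The difference between look-backs [k + m] and [k] is an [excess] with constant [off]. Its second
    moment is bounded uniformly in [m], and Fatou gives [m -> oo]. *)
Lemma Xvar_truncation n k : square_integrable P (fun t => X n t - Xt n k t) /\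
  E (fun t => (X n t - Xt n k t) ^+ 2) <= C * (gam ^+ k) ^+ 2.
Proof.
pose f_ m t := excess h (fun=> k) (window n%:Z (k + m).+1 t).
have f_E m t : f_ m t = Xt n (k + m) t - Xt n k t.
  by rewrite /f_ /Xt !windowS /= take_window// leq_addr.
apply: (@fatou_square _ _ _ P f_).
- by move=> m; exact: window_square_integrable.
- by apply: measurable_funB; [exact: measurable_X|have [] := Xt_sq n k].
- apply: filterS (ae_recurs n) => t /Xvar_eventually[M HM].
  apply: cvg_near_cst; exists M => // m /= Mm.
  by rewrite f_E HM// (leq_trans Mm)// leq_addl.
- move=> m; have [_ ->] := window_integral hb (fun s => excess h (fun=> k) s ^+ 2) n%:Z (k + m).+1.
  exact: (word_mean_excess_sqr A1 h_incr (fun=> k)).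
Qed.

Lemma X_square_integrable n : square_integrable P (X n).
Proof.
have [H _] := Xvar_truncation n 0.
have := square_integrableD H (Xt_sq n 0); congr square_integrable.
by apply/funext => t; rewrite subrK.
Qed.

Let X_int n : Rintegrable P (X n). Proof. exact: square_integrable_int (X_square_integrable n). Qed.

Lemma mean_Xt n m : E (Xt n m) = word_mean m.+1 gain.
Proof. by have [] := window_integral hb gain n%:Z m.+1. Qed.

(** The means at times [n] and 1 are both approximated by the same word mean, with an error of order
    [gam ^+ m] for every [m]. *)
Lemma mean_X n : E (X n) = mu_X P b.
Proof.
have H k m : `|E (X k) - word_mean m.+1 gain| <= (1 + C) * gam ^+ m.
  have [S1 H1] := Xvar_truncation k m.
  rewrite -(mean_Xt k) -meanB//; last by apply: square_integrable_int; exact: Xt_sq.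
  have g0 : 0 < gam ^+ m by rewrite exprn_gt0.
  apply: le_trans (norm_mean_sqr_le S1 g0) _; rewrite mulrDl mul1r lerD2l.
  by rewrite mulrC ler_pdivrMr// -mulrA -expr2.
have -> : mu_X P b = E (X 1) by rewrite /mu_X unlock.
have H2 m : `|E (X n) - E (X 1)| <= 2 * (1 + C) * gam ^+ m.
  have := H n m; have := H 1 m; rewrite distrC.
  have := ler_normD (E (X n) - word_mean m.+1 gain) (word_mean m.+1 gain - E (X 1)).
  by rewrite addrA subrK; lra.
have cv : 2 * (1 + C) * gam ^+ m @[m --> \oo] --> 2 * (1 + C) * 0.
  apply: cvgM; first exact: cvg_cst.
  by apply: cvg_expr; rewrite ger0_norm// ltW.
apply/eqP; rewrite -subr_eq0 -normr_le0 -(mulr0 (2 * (1 + C))) -(cvg_lim _ cv)//.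
apply: limr_ge; first by apply/cvg_ex; eexists; exact: cv.
exact: nearW.
Qed.

Let S K t := \sum_(1 <= k < K.+1) (X k t - mu_X P b).
(** The word made of blocks 1 to [K]: the look-back at time [i + 1] is limited to [i] blocks, and
    centring uses the mean of the truncated sum itself. *)
Let U K t := Z (window K%:Z K t) - word_mean K Z.
Let r K t := S K t - U K t.

Let ZE K t : Z (window K%:Z K t) = \sum_(i < K) Xt i.+1 i t.
Proof.
elim: K => [|K IH]; first by rewrite big_ord0.
have wS : window K.+1%:Z K.+1 t = b K.+1%:Z t :: window K%:Z K t.
  by rewrite windowS (_ : K.+1%:Z - 1 = K%:Z)//; lia.
by rewrite big_ord_recr /= -IH addrC /Xt wS.
Qed.

Let SE K t : S K t = \sum_(i < K) (X i.+1 t - mu_X P b).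
Proof. by rewrite /S big_add1 /= big_mkord. Qed.

Let U_sq K : square_integrable P (U K).
Proof. by apply: (window_square_integrable hb (fun s => Z s - word_mean K Z)). Qed.

Let S_sq K : square_integrable P (S K).
Proof.
rewrite (_ : S K = fun t => \sum_(i < K) (X i.+1 t - mu_X P b)).
  apply: square_integrable_sum => i.
  by apply: square_integrableB; [exact: X_square_integrable|exact: square_integrable_cst].
by apply/funext => t; exact: SE.
Qed.

Let E_S K : E (S K) = 0.
Proof.
rewrite (_ : S K = fun t => \sum_(i < K) (X i.+1 t - mu_X P b)); last first.
  by apply/funext => t; exact: SE.
have I i : Rintegrable P (fun t => X i.+1 t - mu_X P b).
  by apply: RintegrableB => //; exact: Rintegrable_cst.
have [_ ->] := mean_sum (index_enum 'I_K) (fun i : 'I_K => I i).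
rewrite big1// => i _; rewrite meanB//; last exact: Rintegrable_cst.
by rewrite mean_X mean_cst subrr.
Qed.

Let E_U K : E (U K) = 0.
Proof.
have [_ ->] := window_integral hb (fun s => Z s - word_mean K Z) K%:Z K.
by rewrite word_meanB (word_mean_cst A0) subrr.
Qed.

Let E_U2 K : E (fun t => U K t ^+ 2) = word_var K Z.
Proof. by have [_ ->] := window_integral hb (fun s => (Z s - word_mean K Z) ^+ 2) K%:Z K. Qed.

Let r_sq K : square_integrable P (r K). Proof. exact: square_integrableB. Qed.

Let C' : R := C / (1 - gam) ^+ 2.

(** Up to the constant [a], the remainder is the sum of the truncation errors [D i], of L^2 norm at
    most of order [gam ^+ i]. As the remainder is centred, dropping [a] can only increase the second
    moment; Cauchy-Schwarz with weights [gam ^+ i] does the rest. *)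
Lemma mean_remainder_sqr K : E (fun t => r K t ^+ 2) <= C'.
Proof.
pose D i t := X i.+1 t - Xt i.+1 i t.
have D_sq i : square_integrable P (D i) by have [] := Xvar_truncation i.+1 i.
pose SD t := \sum_(i < K) D i t.
have SD_sq : square_integrable P SD by apply: square_integrable_sum => i.
pose a : R := word_mean K Z - K%:R * mu_X P b.
have rE t : r K t = SD t + a.
  rewrite /r SE /U ZE /SD /D !sumrB sumr_const card_ord /a mulr_natl; ring.
have r0 : E (r K) = 0.
  by rewrite meanB ?E_S ?E_U ?subrr//; exact: square_integrable_int.
have Ea : E SD = - a.
  move: r0; rewrite (_ : r K = fun t => SD t + a); last by apply/funext.
  rewrite meanD ?mean_cst; [|exact: square_integrable_int|exact: Rintegrable_cst].
  by move=> /eqP; rewrite addr_eq0 => /eqP.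
have -> : E (fun t => r K t ^+ 2) = E (fun t => SD t ^+ 2) - a ^+ 2.
  rewrite (_ : (fun t => r K t ^+ 2) = fun t => (SD t ^+ 2 + 2 * a * SD t) + a ^+ 2).
    have I1 := SD_sq.2; have I2 := square_integrable_int SD_sq.
    have I3 := RintegrableZ (2 * a) I2; have I4 := RintegrableD I1 I3.
    by rewrite (meanD I4 (Rintegrable_cst P _)) (meanD I1 I3) (meanZ _ I2) mean_cst Ea; ring.
  by apply/funext => t; rewrite rE; ring.
apply: (@le_trans _ _ (E (fun t => SD t ^+ 2))); first by rewrite gerBl sqr_ge0.
pose W := \sum_(i < K) gam ^+ i.
have IQ (i : nat) : Rintegrable P (fun t => (gam ^+ i)^-1 * D i t ^+ 2).
  by apply: RintegrableZ; exact: (D_sq i).2.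
have [IQ2 EQ] := mean_sum (index_enum 'I_K) (fun i : 'I_K => IQ i).
apply: (@le_trans _ _ (E (fun t => W * \sum_(i < K) (gam ^+ i)^-1 * D i t ^+ 2))).
  apply: mean_le; [exact: SD_sq.2|exact: RintegrableZ|].
  move=> t; have := @weighted_cauchy_schwarz _ (fun i => gam ^+ i) (fun i => D i t) K.
  under [X in _ -> _ <= _ * X]eq_bigr do rewrite mulrC.
  by apply => i; rewrite exprn_gt0.
have W0 : 0 <= W by apply: sumr_ge0 => i _; rewrite exprn_ge0// ltW.
rewrite meanZ// EQ.
have W1 : W <= (1 - gam)^-1 by apply: sum_geometric_le => //; exact: ltW.
apply: (@le_trans _ _ (W * (C * W))).
  rewrite ler_wpM2l// /W mulr_sumr; apply: ler_sum => i _.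
  have gi : 0 < gam ^+ i by rewrite exprn_gt0.
  rewrite meanZ; last exact: (D_sq i).2.
  rewrite mulrC ler_pdivrMr// -mulrA -expr2.
  by have [] := Xvar_truncation i.+1 i.
rewrite mulrCA /C' -exprVn ler_wpM2l// -expr2 lerXn2r// nnegrE.
by rewrite invr_ge0 subr_ge0 ltW.
Qed.

Let C'0 : 0 <= C'. Proof. by rewrite divr_ge0// sqr_ge0. Qed.

Let W K t := (Num.sqrt (K%:R : R))^-1 * S K t.

Let W_sq K : square_integrable P (W K). Proof. exact: square_integrableZ. Qed.

(** Here [2 |u v| <= q v^2 + u^2 / q] with [q = sqrt K]: the remainder has bounded second moment and
    the variance of [U] is of order [K], so after division by [K] both parts are of order
    [1 / sqrt K]. *)
Let EW2_dist K : (0 < K)%N ->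
  `|E (fun t => W K t ^+ 2) - word_var K Z / K%:R| <=
  (2 * C' + word_var K Z / K%:R) / Num.sqrt K%:R.
Proof.
move=> K0; set q := Num.sqrt K%:R.
have K1 : 1 <= K%:R :> R by rewrite ler1n.
have q1 : 1 <= q by rewrite /q -[leLHS]sqrtr1 ler_wsqrtr.
have q0 : 0 < q by exact: lt_le_trans q1.
have q2 : K%:R = q ^+ 2 by rewrite sqr_sqrtr.
have IS := (S_sq K).2; have IU := (U_sq K).2; have Ir := (r_sq K).2.
have -> : E (fun t => W K t ^+ 2) = q ^- 2 * E (fun t => S K t ^+ 2).
  by rewrite -meanZ//; apply: eq_Rintegral => t _; rewrite exprMn exprVn.
rewrite -E_U2 q2 mulrC -mulrBl -meanB// normrM (@ger0_norm _ (q ^- 2)) ?invr_ge0 ?sqr_ge0//.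
have I1 : Rintegrable P (fun t => (q + 1) * r K t ^+ 2) by exact: RintegrableZ.
have I2 : Rintegrable P (fun t => q^-1 * U K t ^+ 2) by exact: RintegrableZ.
have H : `|E (fun t => S K t ^+ 2 - U K t ^+ 2)| <=
    (q + 1) * E (fun t => r K t ^+ 2) + q^-1 * E (fun t => U K t ^+ 2).
  rewrite -!meanZ// -meanD//; apply: norm_mean_le; [exact: RintegrableB|exact: RintegrableD|].
  move=> t; have -> : S K t = U K t + r K t by rewrite /r addrC subrK.
  set u := U K t; set v := r K t.
  have -> : (u + v) ^+ 2 - u ^+ 2 = 2 * (u * v) + v ^+ 2 by ring.
  have -> : (q + 1) * v ^+ 2 + q^-1 * u ^+ 2 = q * v ^+ 2 + q^-1 * u ^+ 2 + v ^+ 2 by ring.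
  apply: le_trans (ler_normD _ _) _.
  rewrite [ `|v ^+ 2|]ger0_norm ?sqr_ge0// lerD2r ler_norml; apply/andP; split.
    rewrite lerNl -subr_ge0.
    have -> : q * v ^+ 2 + q^-1 * u ^+ 2 - - (2 * (u * v)) = q^-1 * (u + q * v) ^+ 2.
      by field; rewrite gt_eqF.
    by rewrite mulr_ge0 ?sqr_ge0// invr_ge0 ltW.
  rewrite -subr_ge0.
  have -> : q * v ^+ 2 + q^-1 * u ^+ 2 - 2 * (u * v) = q^-1 * (u - q * v) ^+ 2.
    by field; rewrite gt_eqF.
  by rewrite mulr_ge0 ?sqr_ge0// invr_ge0 ltW.
have Hr := mean_remainder_sqr K.
have Hr2 : (q + 1) * E (fun t => r K t ^+ 2) <= 2 * q * C'.
  apply: (@le_trans _ _ ((q + 1) * C')); first by rewrite ler_wpM2l// addr_ge0// ltW.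
  by rewrite ler_wpM2r//; lra.
set V := E (fun t => U K t ^+ 2) in H *.
have -> : (2 * C' + V / q ^+ 2) / q = (2 * q * C' + q^-1 * V) / q ^+ 2.
  by field; rewrite gt_eqF.
by rewrite ler_wpM2r ?invr_ge0 ?sqr_ge0//; move: H Hr2; lra.
Qed.

(** The cosine is 1-Lipschitz, and [|r| <= 1 + r^2] reduces the remainder to its second moment. *)
Let Ecos_dist K t s : (0 < K)%N ->
  `|E (fun x => cos (t * W K x + s)) -
    word_mean K (fun w => cos (s + t / Num.sqrt K%:R * (Z w - word_mean K Z)))| <=
  `|t| * (1 + C') / Num.sqrt K%:R.
Proof.
move=> K0; set q := Num.sqrt K%:R.
have q0 : 0 < q by rewrite sqrtr_gt0 ltr0n.
have [I1 <-] := window_integral hb (fun w => cos (s + t / q * (Z w - word_mean K Z))) K%:Z K.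
have mc (f : T -> R) : measurable_fun setT f -> Rintegrable P (fun x => cos (f x)).
  move=> mf; apply: (@bounded_integrable _ _ _ P _ 1); last by move=> x; exact: cos_max.
  by apply: measurableT_comp => //; apply: continuous_measurable_fun; exact: continuous_cos.
have I2 : Rintegrable P (fun x => cos (t * W K x + s)).
  apply: mc; apply: measurable_funD => //; apply: measurable_funM => //.
  exact: (W_sq K).1.
rewrite -meanB//.
have Ir := (r_sq K).2.
have I3 : Rintegrable P (fun x => `|t| / q * (1 + r K x ^+ 2)).
  by apply: RintegrableZ; apply: RintegrableD => //; exact: Rintegrable_cst.
apply: (@le_trans _ _ (E (fun x => `|t| / q * (1 + r K x ^+ 2)))).
  apply: norm_mean_le => //; first exact: RintegrableB.
  move=> x; apply: le_trans (ler_dist_cos _ _) _.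
  have -> : t * W K x + s - (s + t / q * (Z (window K%:Z K x) - word_mean K Z)) = t / q * r K x.
    by rewrite /W /r /U -/q; ring.
  rewrite !normrM [ `|q^-1|]ger0_norm ?invr_ge0 ?(ltW q0)//.
  rewrite ler_wpM2l ?divr_ge0 ?(ltW q0)//.
  rewrite -[r K x ^+ 2](real_normK (num_real _)).
  by have := sqr_ge0 (`|r K x| - 1); have := normr_ge0 (r K x); nra.
have I4 := RintegrableD (Rintegrable_cst P 1) Ir.
rewrite (meanZ _ I4) (meanD (Rintegrable_cst P 1) Ir) mean_cst.
by rewrite mulrAC ler_wpM2r ?invr_ge0 ?(ltW q0)// ler_wpM2l// lerD2l mean_remainder_sqr.
Qed.

Lemma normalized_sum_limits : exists tau : R, [/\ 0 <= tau,
  forall K, square_integrable P (normalized_sum P b K),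
  forall K, E (normalized_sum P b K) = 0,
  E (fun t => normalized_sum P b K t ^+ 2) @[K --> \oo] --> tau &
  forall t s, E (fun x => cos (t * normalized_sum P b K x + s)) @[K --> \oo] -->
    expR (- (t ^+ 2 * tau / 2)) * cos s].
Proof.
have [tau [tau0 Vtau ctau]] := words_clt A1 h_incr.
exists tau; split => //.
- by move=> K; rewrite (meanZ _ (square_integrable_int (S_sq K))) E_S mulr0.
- have H : (2 * C' + word_var K Z / K%:R) / Num.sqrt K%:R @[K --> \oo] -->
      (2 * C' + tau) * 0.
    by apply: cvgM; [apply: cvgD => //; exact: cvg_cst|exact: inv_sqrt_cvg0].
  rewrite mulr0 in H.
  have H2 : E (fun t => W K t ^+ 2) - word_var K Z / K%:R @[K --> \oo] --> (0 : R).
    apply: norm_cvg0; apply: (@squeeze_cvgr _ _ _ _ (fun=> 0) _ _ _ _ _ H).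
      by near=> K; rewrite normr_ge0 /= EW2_dist//; near: K; exists 1%N.
    exact: cvg_cst.
  have H3 := cvgD H2 Vtau; rewrite add0r in H3.
  rewrite [X in X @ _ --> _](_ : _ = (fun K => E (fun t => W K t ^+ 2) -
    word_var K Z / K%:R) + (fun K => word_var K Z / K%:R)); first exact: H3.
  by apply/funext => K; rewrite fctE subrK.
- move=> t s.
  have H : `|t| * (1 + C') / Num.sqrt K%:R @[K --> \oo] --> `|t| * (1 + C') * 0.
    by apply: cvgM; [exact: cvg_cst|exact: inv_sqrt_cvg0].
  rewrite mulr0 in H.
  have H2 : E (fun x => cos (t * W K x + s)) -
    word_mean K (fun w => cos (s + t / Num.sqrt K%:R * (Z w - word_mean K Z))) @[K --> \oo] --> (0 : R).
    apply: norm_cvg0; apply: (@squeeze_cvgr _ _ _ _ (fun=> 0) _ _ _ _ _ H).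
      by near=> K; rewrite normr_ge0 /= Ecos_dist//; near: K; exists 1%N.
    exact: cvg_cst.
  have H3 := cvgD H2 (ctau t s); rewrite add0r in H3.
  rewrite [X in X @ _ --> _](_ : _ = (fun K => E (fun x => cos (t * W K x + s)) -
    word_mean K (fun w => cos (s + t / Num.sqrt K%:R * (Z w - word_mean K Z)))) +
    (fun K => word_mean K (fun w => cos (s + t / Num.sqrt K%:R * (Z w - word_mean K Z))))).
    exact: H3.
  by apply/funext => K; rewrite fctE subrK.
Unshelve. all: by end_near. Qed.

End stationary_sums.

Theorem theorem4p1 (L : nat) (hL : (1 <= L)%N)
    (R : realType) (d : measure_display) (T : measurableType d)
    (P : probability T R) (b : int -> {RV P >-> L.-tuple bool})
    (hb : iid_uniform_blocks P b) :
  cvg_in_distribution P (normalized_sum P b) (normal_law 0%R (tau_X P b)).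
Proof.
have [tau [tau0 Wsq EW0 EW2 Ecos]] := normalized_sum_limits hL hb.
have tauE : tau_X P b = tau.
  rewrite /tau_X.
  (* The normalized sums are centred, so their variances are their second moments. *)
  have -> : (fun K => 'V_P[normalized_sum P b K]%E) =
      (fun K => (\int[P]_t (normalized_sum P b K t ^+ 2))%:E).
    apply/funext => K.
    have E0 : ('E_P[normalized_sum P b K] = 0)%E.
      have IW := square_integrable_int (Wsq K).
      have fW := integrable_fin_num measurableT IW.
      by rewrite unlock -(fineK fW); congr EFin; exact: EW0.
    rewrite /variance unlock E0 /= unlock /Rintegral fineK; last first.
      by apply: integrable_fin_num => //; exact: (Wsq K).2.
    by apply: eq_integral => t _; rewrite !fctE /= subr0 expr2.
  have cE : (\int[P]_t (normalized_sum P b K t ^+ 2))%:E @[K --> \oo] --> tau%:E.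
    by apply: cvg_EFin; [exact: nearW|exact: EW2].
  by rewrite (cvg_lim _ cE).
rewrite tauE => f cf bf.
apply: (cvg_in_distribution_cos (X := normalized_sum P b)) => //.
- by move=> t s; rewrite normal_law_cos//; exact: Ecos.
- move=> e e0.
  (* Tightness by Chebyshev's inequality: [A] solves [(tau + 1) / A^2 = e]. The added 1 dominates
     the second moments for large [K] and keeps [A] positive when [tau = 0]. *)
  have pos : 0 < (tau + 1) / e by rewrite divr_gt0// ltr_wpDl.
  pose A := Num.sqrt ((tau + 1) / e).
  have A0 : 0 < A by rewrite sqrtr_gt0.
  exists A; split => //.
  have := EW2 => /cvgrPdist_lt /(_ _ ltr01) EW2n.
  near=> K.
  have EK : \int[P]_t (normalized_sum P b K t ^+ 2) <= tau + 1.
    have : `|tau - \int[P]_t (normalized_sum P b K t ^+ 2)| < 1 by near: K.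
    by rewrite ltr_norml => /andP[? ?]; lra.
  pose B := [set t | A < `|normalized_sum P b K t|].
  have mB : measurable B.
    rewrite (_ : B = (fun t => `|normalized_sum P b K t|) @^-1` `]A, +oo[).
      rewrite -[X in measurable X]setTI; apply: measurableT_comp => //.
    by apply/seteqP; split => x /=; rewrite in_itv/= andbT.
  have fB : P B \is a fin_num by exact: fin_num_measure.
  rewrite -[leLHS](fineK fB) lee_fin.
  have I2 := RintegrableZ (A ^- 2) (Wsq K).2.
  have I1 : Rintegrable P (\1_B : T -> R).
    apply: (@bounded_integrable _ _ _ P _ 1); first exact: measurable_indic.
    by move=> x; rewrite indicE; case: (_ \in _); rewrite ?normr1 ?normr0.
  have -> : fine (P B) = \int[P]_t (\1_B t).
    by rewrite /Rintegral integral_indic ?setIT.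
  apply: (le_trans (mean_le I1 I2 _)).
    move=> t; rewrite indicE; have [|_] := boolP (t \in B); last first.
      by rewrite mulr_ge0 ?sqr_ge0// invr_ge0 sqr_ge0.
    rewrite inE => /ltW At; rewrite mulrC ler_pdivlMr ?exprn_gt0// mul1r.
    rewrite -[leRHS](real_normK (num_real _)).
    by rewrite lerXn2r ?nnegrE ?(ltW A0).
  rewrite meanZ; last exact: (Wsq K).2.
  rewrite /A sqr_sqrtr ?(ltW pos)// invf_div mulrAC ler_pdivrMr ?ltr_wpDl//.
  by rewrite ler_wpM2l// ltW.
Unshelve. all: by end_near. Qed.
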